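(* Let $\kappa \in (0,1)$. Let $p_{\kappa} = \wp(\,\cdot\,; g_2, g_3)$ be the Weierstrass $\wp$ function with invariants $$g_2 = \tfrac43 - \kappa^2, \qquad g_3 = \tfrac{8}{27} - \tfrac13 \kappa^2,$$ and let $\rho_{\kappa}$ (Shen's function $\mathrm{dn}_2$) be the elliptic function defined by $(1 - \rho_{\kappa})(\tfrac13 + p_{\kappa}) = \tfrac12 \kappa^2$. Let $(2\omega_{\kappa}, 2\omega_{\kappa}')$ be the fundamental pair of periods of $p_{\kappa}$ (equivalently of $\rho_{\kappa}$) for which $\omega_{\kappa}$ and $-i\,\omega_{\kappa}'$ are strictly positive. Then $$\omega_{\kappa} = \tfrac12 \pi\, F(\tfrac14, \tfrac34; 1; \kappa^2), \qquad \omega_{\kappa}' = i\,\tfrac{\sqrt2}{2}\pi\, F(\tfrac14, \tfrac34; 1; 1-\kappa^2).$$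
   Context: $F(a,b;c;x)$ denotes the Gauss hypergeometric function ${}_2F_1$. $\wp(\,\cdot\,; g_2, g_3)$ is the Weierstrass elliptic function with invariants $g_2,g_3$. Background on $\rho_\kappa$: if $\phi:\mathbb{R}\to\mathbb{R}$ is the inverse of $T \mapsto \int_0^T F(\tfrac14,\tfrac34;\tfrac12;\kappa^2\sin^2 t)\,dt$ and $\psi = \arcsin(\kappa \sin\phi)$, then $\cos\psi$ is the restriction to $\mathbb{R}$ of $\rho_\kappa$; this is how Shen's elliptic function $\mathrm{dn}_2$ arises. *)

(* Defs.v *)
From HB Require Import structures.
From mathcomp Require Import all_boot all_order all_algebra.
From mathcomp Require Import all_classical all_reals all_analysis.
From mathcomp Require Import complex.
From mathcomp Require showcase.summability.

Set Implicit Arguments.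
Unset Strict Implicit.
Unset Printing Implicit Defensive.

Import Order.TTheory GRing.Theory Num.Theory.
Import numFieldNormedType.Exports.

Local Open Scope classical_set_scope.
Local Open Scope complex_scope.
Local Open Scope ring_scope.

Definition pochhammer (R : realType) (a : R) (n : nat) : R :=
  \prod_(i < n) (a + i%:R).

(* Meaningful for `|x| < 1 and c not a nonpositive integer; a divergent series
   gets the default value of lim. *)
Definition hypergeo2F1 (R : realType) (a b c x : R) : R :=
  limn [series pochhammer a n * pochhammer b n
               / (pochhammer c n * n`!%:R) * x ^+ n]_n.

Definition zspan (R : realType) (w1 w2 : R[i]) : set R[i] :=
  [set z | exists m n : int, z = m%:~R * w1 + n%:~R * w2].

(* Im (w2 / w1) != 0 is linear independence of w1, w2 over the reals; since
   w1^-1 = 0 when w1 = 0, it also excludes w1 = 0. *)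
Definition is_lattice (R : realType) (L : set R[i]) : Prop :=
  exists w1 w2 : R[i], complex.Im (w2 / w1) != 0 /\ L = zspan w1 w2.

(* Sum of f over L \ {0}, as the limit of its finite partial sums along the
   finite sets ordered by inclusion (unconditional summation). *)
Definition lattice_sum (R : realType) (L : set R[i]) (f : R[i] -> R[i]) : R[i] :=
  summability.sum
    ((fun l => if (l \in L) && (l != 0) then f l else 0) : R[i] -> R[i]^o).

Definition invariant_g2 (R : realType) (L : set R[i]) : R[i] :=
  60 * lattice_sum L (fun l => l ^- 4).

Definition invariant_g3 (R : realType) (L : set R[i]) : R[i] :=
  140 * lattice_sum L (fun l => l ^- 6).

(* A meromorphic function on the plane is a map into the Riemann sphere, encoded
   as option R[i]: None is the point at infinity, i.e. the value at a pole. *)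
Definition weierstrassP (R : realType) (L : set R[i]) (z : R[i]) :
    option R[i] :=
  if z \in L then None
  else Some (z ^- 2 + lattice_sum L (fun l => (z - l) ^- 2 - l ^- 2)).

Definition is_weierstrassP (R : realType) (g2 g3 : R[i])
    (p : R[i] -> option R[i]) : Prop :=
  exists L : set R[i], [/\ is_lattice L, invariant_g2 L = g2,
    invariant_g3 L = g3 & p = weierstrassP L].

(* Shen's dn_2: (1 - dn2) * (1/3 + p) = k^2/2 solved for dn2 on the Riemann
   sphere; dn2 is 1 at the poles of p and has its poles where p = -1/3. *)
Definition dn2 (R : realType) (k : R) (p : R[i] -> option R[i]) (z : R[i]) :
    option R[i] :=
  if p z is Some v then
    if 3^-1 + v == 0 then None
    else Some (1 - (k ^+ 2 / 2)%:C / (3^-1 + v))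
  else Some 1.

Lemma dn2P (R : realType) (k : R) (p : R[i] -> option R[i]) (z v r : R[i]) :
  k != 0 -> p z = Some v ->
  dn2 k p z = Some r <-> (1 - r) * (3^-1 + v) = (k ^+ 2 / 2)%:C.
Proof.
move=> k0 pz; rewrite /dn2 pz; case: eqVneq => [v0|v0].
  split=> //; rewrite v0 mulr0 => /esym/eqP.
  by rewrite eq_complex /= eqxx andbT mulf_eq0 sqrf_eq0 (negPf k0)
             invr_eq0 pnatr_eq0.
split=> [[<-]|<-]; first by rewrite subKr divfK.
by rewrite mulfK// subKr.
Qed.

Definition periods (R : realType) (f : R[i] -> option R[i]) : set R[i] :=
  [set w | forall z, f (z + w) = f z].

Definition is_fundamental_pair (R : realType) (f : R[i] -> option R[i])
    (w1 w2 : R[i]) : Prop :=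
  complex.Im (w2 / w1) != 0 /\ periods f = zspan w1 w2.

(* Main.v *)
(* Write u = z - l for l in the lattice, r for a nonzero lattice point, v = u - r,
   S_k = sum_l (z - l)^-k, and P for the Weierstrass function.  For r <> 0,
     3 u^-4 (v^-2 - r^-2) + 2 u^-3 v^-3
       = 4 r^-3 u^-3 + 2 r^-3 v^-3 + 3 r^-4 (u^-2 - v^-2),
   and everything is absolutely summable over pairs (u, r).  Summing over r first
   gives 3 P S_4 + 2 S_3^2 - 5 S_6 on the left; summing over u first gives 0 on the
   right.  Since P' = -2 S_3 and S_k' = -k S_(k+1), this says (S_4 - P^2)'' = 0,
   whence the differential equation P'^2 = 4 P^3 - g2 P - g3 without any complex
   analysis.

   On a rectangular lattice P is real on the real axis and decreases from +oo to the
   largest root e1 on (0, omega).  With k' = sqrt (1 - k^2) the roots are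
   1/6 + k'/2, 1/6 - k'/2 and -1/3, and a rational function y of P satisfies
   y'^2 = C (1 - m y) (1 - y^2), running from -1 to 1: for the real period C = 4 and
   m = k, for the imaginary one (rotate the lattice, so that g3 changes sign)
   C = 2 and m = k'.  Therefore
     sqrt C * omega = int_(-pi/2)^(pi/2) (1 - m sin t)^(-1/2) dt,
   and expanding the integrand in powers of m gives pi F(1/4, 3/4; 1; m^2). *)

Require Import Defs.
From HB Require Import structures.
From mathcomp Require Import all_boot all_order all_algebra finmap.
From mathcomp Require Import all_classical all_reals all_analysis.
From mathcomp Require Import complex ring lra zify.
From mathcomp Require showcase.summability.

Set Implicit Arguments.
Unset Strict Implicit.
Unset Printing Implicit Defensive.

Import Order.TTheory GRing.Theory Num.Theory.
Import numFieldNormedType.Exports.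
Import Normc.

Local Open Scope classical_set_scope.
Local Open Scope fset_scope.
Local Open Scope complex_scope.
Local Open Scope ring_scope.

(** * Unordered sums of complex families *)

(** Absolute summability rests on one comparison: the index (m, n) has weight 1 / (|m| + |n| + 1),
    whose cube is summable. The obstacle is S_2, which is not absolutely convergent, so shifting it
    by a lattice point is not a mere reindexing. Telescoping along rows and columns repairs this; it
    gives the periodicity of P and, together with the vanishing of the odd Eisenstein sums, the 0 on
    the right of the overview.

    The integration constants of the differential equation are found by comparing Laurent expansions
    at 0 along the real axis, which brings in G_4 and G_6.

    The time integral is never formed. With y = sin th, a truncated binomial series has an explicit
    primitive in th, and the mean value theorem compares its increment with sqrt C * omega up to O(N
    m^N).

    The hypothesis on p only asserts that some lattice exists. That lattice is the set of periods of
    P, so the given pair spans it, and the positivity conditions make it rectangular. *)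

Lemma normc_ge0 (R : realType) (x : R[i]) : 0 <= normc x.
Proof. by case: x => a b; exact: sqrtr_ge0. Qed.

Lemma normc_real (R : realType) (x : R) : normc x%:C = `|x|.
Proof. by rewrite /= expr0n addr0 sqrtr_sqr. Qed.

Lemma normc_distrC (R : realType) (x y : R[i]) : normc (x - y) = normc (y - x).
Proof. by rewrite -normcN opprB. Qed.

Lemma normcX (R : realType) (x : R[i]) n : normc (x ^+ n) = normc x ^+ n.
Proof. by elim: n => [|n IH]; rewrite ?expr0 ?normc1// !exprS normcM IH. Qed.

Lemma normc_gt0 (R : realType) (x : R[i]) : (0 < normc x) = (x != 0).
Proof.
rewrite lt_def normc_ge0 andbT; congr (~~ _).
by apply/eqP/eqP => [/eq0_normc//|->]; exact: normc0.
Qed.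

Lemma normc_Re (R : realType) (x : R[i]) : `|complex.Re x| <= normc x.
Proof.
case: x => a b /=; rewrite -sqrtr_sqr ler_sqrt ?addr_ge0 ?sqr_ge0//.
by rewrite lerDl sqr_ge0.
Qed.

Lemma normc_Im (R : realType) (x : R[i]) : `|complex.Im x| <= normc x.
Proof.
case: x => a b /=; rewrite -sqrtr_sqr ler_sqrt ?addr_ge0 ?sqr_ge0//.
by rewrite lerDr sqr_ge0.
Qed.

Lemma normc_conj (R : realType) (x : R[i]) : normc x^*%C = normc x.
Proof. by case: x => a b /=; rewrite sqrrN. Qed.

Lemma le_normcB (R : realType) (x y : R[i]) : normc (x - y) <= normc x + normc y.
Proof. by rewrite -(normcN y) le_normcD. Qed.

Lemma le_normc_sum (R : realType) (I : Type) (r : seq I) (f : I -> R[i]) :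
  normc (\sum_(i <- r) f i) <= \sum_(i <- r) normc (f i).
Proof.
elim/big_rec2: _ => [|i y1 y2 _ h]; first by rewrite normc0.
by apply: le_trans (le_normcD _ _) _; rewrite lerD2l.
Qed.

Lemma ler_sum_fset (R : realType) (I : choiceType) (A B : {fset I}) (f : I -> R) :
  (forall i, 0 <= f i) -> A `<=` B -> \sum_(i <- A) f i <= \sum_(i <- B) f i.
Proof.
move=> f0 AB; rewrite [leRHS](big_fsetID _ (mem A))/=.
have -> : [fset x in B | x \in A]%fset = A.
  by apply/fsetP => x; rewrite !inE andb_idl// => /(fsubsetP AB).
by rewrite lerDl sumr_ge0.
Qed.

(** Unconditional summation with a real [e]: [normc] takes values in [R], whereas the norm of [R[i]]
    takes values in [R[i]]. The link with the sums of the statement is [summability_sumE]. *)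
Definition is_sum (R : realType) (I : choiceType) (f : I -> R[i]) (s : R[i]) :=
  forall e : R, 0 < e -> exists A : {fset I}, forall B : {fset I},
    A `<=` B -> normc (\sum_(i <- B) f i - s) <= e.

Definition abs_bounded (R : realType) (I : choiceType) (f : I -> R[i]) (M : R) :=
  forall B : {fset I}, \sum_(i <- B) normc (f i) <= M.

Lemma is_sum_unique (R : realType) (I : choiceType) (f : I -> R[i]) s t :
  is_sum f s -> is_sum f t -> s = t.
Proof.
move=> hs ht; apply/eqP; rewrite -subr_eq0; apply/eqP/eq0_normc.
apply/eqP; rewrite eq_le normc_ge0 andbT; apply/ler_addgt0Pr => e e0.
have e20 : 0 < e / 2 by rewrite divr_gt0.
have [A hA] := hs _ e20; have [B hB] := ht _ e20.
have h1 := hA (A `|` B)%fset (fsubsetUl _ _).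
have h2 := hB (A `|` B)%fset (fsubsetUr _ _).
set x := \sum_(i <- _) _ in h1 h2.
have -> : s - t = (x - t) - (x - s) by ring.
by rewrite add0r (le_trans (le_normcB _ _))// (splitr e) lerD.
Qed.

Lemma eq_is_sum (R : realType) (I : choiceType) (f g : I -> R[i]) s :
  f =1 g -> is_sum f s -> is_sum g s.
Proof.
move=> fg h e /h[A hA]; exists A => B /hA.
by rewrite (eq_bigr g).
Qed.

Lemma is_sum0 (R : realType) (I : choiceType) : is_sum (fun _ : I => 0 : R[i]) 0.
Proof.
move=> e e0; exists fset0 => B _; rewrite big1// subr0 normc0; exact: ltW.
Qed.

Lemma is_sumD (R : realType) (I : choiceType) (f g : I -> R[i]) s t :
  is_sum f s -> is_sum g t -> is_sum (fun i => f i + g i) (s + t).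
Proof.
move=> hs ht e e0.
have e20 : 0 < e / 2 by rewrite divr_gt0.
have [A hA] := hs _ e20; have [B hB] := ht _ e20.
exists (A `|` B)%fset => D; rewrite fsubUset => /andP[/hA h1 /hB h2].
rewrite big_split/= opprD addrACA (le_trans (le_normcD _ _))//.
by rewrite (splitr e) lerD.
Qed.

Lemma is_sumZ (R : realType) (I : choiceType) (c : R[i]) (f : I -> R[i]) s :
  is_sum f s -> is_sum (fun i => c * f i) (c * s).
Proof.
move=> hs e e0; have [->|c0] := eqVneq c 0.
  exists fset0 => B _; rewrite big1 => [|i _]; rewrite mul0r// subr0 normc0.
  exact: ltW.
have nc : 0 < normc c by rewrite normc_gt0.
have [A hA] := hs (e / normc c) (divr_gt0 e0 nc).
exists A => B /hA h; rewrite -mulr_sumr -mulrBr normcM.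
by rewrite mulrC -ler_pdivlMr.
Qed.

Lemma is_sumN (R : realType) (I : choiceType) (f : I -> R[i]) s :
  is_sum f s -> is_sum (fun i => - f i) (- s).
Proof.
move=> /(is_sumZ (-1)); rewrite mulN1r; apply: eq_is_sum => i.
by rewrite mulN1r.
Qed.

Lemma is_sumB (R : realType) (I : choiceType) (f g : I -> R[i]) s t :
  is_sum f s -> is_sum g t -> is_sum (fun i => f i - g i) (s - t).
Proof. by move=> hs /is_sumN; exact: is_sumD. Qed.

Lemma is_sum_conj (R : realType) (I : choiceType) (f : I -> R[i]) s :
  is_sum f s -> is_sum (fun i => (f i)^*%C) s^*%C.
Proof.
move=> hs e /hs[A hA]; exists A => B /hA.
rewrite -normc_conj rmorphB/= rmorph_sum//=.
Qed.

Lemma is_sum_reindex (R : realType) (I J : choiceType) (h : I -> J) (h' : J -> I)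
    (f : J -> R[i]) s :
  cancel h h' -> cancel h' h -> is_sum f s -> is_sum (f \o h) s.
Proof.
move=> hK h'K hs e /hs[A hA]; exists [fset h' x | x in A]%fset => B AB.
have hi : injective h by exact: can_inj hK.
have := hA [fset h x | x in B]%fset; rewrite big_imfset/=; last by move=> ? ? _ _; exact: hi.
apply; apply/fsubsetP => x xA; apply/imfsetP; exists (h' x) => //=.
by apply: (fsubsetP AB); apply/imfsetP; exists x.
Qed.

Lemma is_sum_norm (R : realType) (I : choiceType) (f : I -> R[i]) s M :
  is_sum f s -> abs_bounded f M -> normc s <= M.
Proof.
move=> hs hM; apply/ler_addgt0Pr => e e0; have [A /(_ A (fsubset_refl _))] := hs e e0.
set x := \sum_(i <- _) _ => h.
have -> : s = x - (x - s) by ring.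
apply: le_trans (le_normcB _ _) _; apply: lerD => //.
by apply: le_trans (le_normc_sum _ _) _; exact: hM.
Qed.

Lemma is_sum_ge0 (R : realType) (I : choiceType) (f : I -> R) (M : R) :
  (forall i, 0 <= f i) -> (forall B : {fset I}, \sum_(i <- B) f i <= M) ->
  exists s : R, is_sum (fun i => (f i)%:C) s%:C.
Proof.
move=> f0 fM.
pose E := [set x | exists B : {fset I}, x = \sum_(i <- B) f i].
have hE : has_sup E.
  split; first by exists 0, fset0; rewrite big_seq_fset0.
  by exists M => _ [B ->]; exact: fM.
exists (sup E) => e e0.
have [_ [A ->] hA] := sup_adherent e0 hE.
exists A => B AB; rewrite -rmorph_sum -rmorphB normc_real.
have h1 : \sum_(i <- B) f i <= sup E by apply: ub_le_sup; [case: hE|exists B].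
have h2 := ler_sum_fset f0 AB.
rewrite ler_norml; apply/andP; split; lra.
Qed.

(** The real and imaginary parts g are split as (|g| + g) - |g|, a difference of nonnegative
    families, whose finite sums converge to their supremum. *)
Lemma abs_bounded_is_sum (R : realType) (I : choiceType) (f : I -> R[i]) (M : R) :
  abs_bounded f M -> exists s, is_sum f s.
Proof.
move=> fM.
have key (g : I -> R) : (forall i, `|g i| <= normc (f i)) ->
    exists s : R, is_sum (fun i => (g i)%:C) s%:C.
  move=> gf.
  have [s1 h1] : exists s : R, is_sum (fun i => (`|g i| + g i)%:C) s%:C.
    apply: (@is_sum_ge0 _ _ _ (M + M)) => [i|B].
      by rewrite -lerBlDr sub0r ler_normr lexx orbT.
    rewrite big_split/= lerD// (le_trans _ (fM B))// ler_sum// => i _.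
    exact: le_trans (ler_norm _) (gf i).
  have [s2 h2] : exists s : R, is_sum (fun i => (`|g i|)%:C) s%:C.
    apply: (@is_sum_ge0 _ _ _ M) => // B.
    by rewrite (le_trans _ (fM B))// ler_sum.
  exists (s1 - s2); rewrite rmorphB/=; apply: eq_is_sum (is_sumB h1 h2) => i /=.
  by rewrite -!rmorphB/=; congr (_%:C); ring.
have [a ha] := key (fun i => complex.Re (f i)) (fun i => normc_Re (f i)).
have [b hb] := key (fun i => complex.Im (f i)) (fun i => normc_Im (f i)).
exists (a%:C + 'i%C * b%:C); apply: eq_is_sum (is_sumD ha (is_sumZ 'i%C hb)) => i.
by rewrite -complexE.
Qed.

Lemma le_abs_bounded (R : realType) (I : choiceType) (f g : I -> R[i]) (M c : R) :
  0 <= c -> (forall i, normc (f i) <= c * normc (g i)) ->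
  abs_bounded g M -> abs_bounded f (c * M).
Proof.
move=> c0 fg gM B; apply: le_trans (ler_wpM2l c0 (gM B)).
by rewrite mulr_sumr ler_sum.
Qed.

Lemma le_abs_boundedD (R : realType) (I : choiceType) (f g h : I -> R[i]) (M N c : R) :
  0 <= c -> (forall i, normc (f i) <= c * (normc (g i) + normc (h i))) ->
  abs_bounded g M -> abs_bounded h N -> abs_bounded f (c * (M + N)).
Proof.
move=> c0 fgh gM hN B; apply: le_trans (ler_wpM2l c0 (lerD (gM B) (hN B))).
by rewrite -big_split mulr_sumr ler_sum.
Qed.

Lemma abs_bounded_reindex (R : realType) (I J : choiceType) (h : I -> J)
    (f : J -> R[i]) M :
  injective h -> abs_bounded f M -> abs_bounded (f \o h) M.
Proof.
move=> hi fM B; have := fM [fset h x | x in B]%fset.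
by rewrite big_imfset//= => ? ? _ _; exact: hi.
Qed.

Lemma big_fsetM (V : nmodType) (I J : choiceType) (A : {fset I}) (B : {fset J})
    (F : I * J -> V) :
  \sum_(p <- (A `*` B)%fset) F p = \sum_(i <- A) \sum_(j <- B) F (i, j).
Proof.
transitivity (\sum_(p <- [seq (i, j) | i <- enum_fset A, j <- enum_fset B]) F p);
  last by rewrite big_allpairs_dep.
apply: perm_big; apply: uniq_perm; first exact: fset_uniq.
  by apply: allpairs_uniq => // -[? ?] [? ?].
move=> [i j]; rewrite in_fsetM/=; apply/andP/allpairsP => [[iA jB]|[[x y]/= [xA yB [-> ->]]]//].
by exists (i, j).
Qed.

Lemma fsub_fsetM (I J : choiceType) (D : {fset I * J}) :
  (D `<=` [fset x.1 | x in D] `*` [fset x.2 | x in D])%fset.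
Proof.
apply/fsubsetP => x xD; rewrite in_fsetM.
by apply/andP; split; apply/imfsetP; exists x.
Qed.

Lemma abs_bounded_mul (R : realType) (I J : choiceType) (f : I -> R[i])
    (g : J -> R[i]) (M N : R) :
  abs_bounded f M -> abs_bounded g N ->
  abs_bounded (fun p : I * J => f p.1 * g p.2) (M * N).
Proof.
move=> fM gN D.
apply: le_trans (ler_sum_fset (fun i => normc_ge0 _) (fsub_fsetM D)) _.
rewrite big_fsetM; under eq_bigr do under eq_bigr do rewrite /= normcM.
under eq_bigr do rewrite -mulr_sumr.
rewrite -mulr_suml ler_pM ?sumr_ge0//; first by move=> *; exact: normc_ge0.
by move=> *; exact: normc_ge0.
Qed.

(** Once B contains the first projections of a good finite set A, a large enough D makes the product
    B x D contain A, while all inner sums over D with i in B are close to g i. *)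
Lemma is_sum_fubini (R : realType) (I J : choiceType) (f : I * J -> R[i]) s
    (g : I -> R[i]) :
  is_sum f s -> (forall i, is_sum (fun j => f (i, j)) (g i)) -> is_sum g s.
Proof.
move=> hs hg e e0; have e20 : 0 < e / 2 by rewrite divr_gt0.
have [A hA] := hs _ e20; exists [fset x.1 | x in A]%fset => B AB.
have [D0 hD0] : exists D0 : {fset J}, forall D : {fset J}, D0 `<=` D ->
    normc (\sum_(i <- B) (\sum_(j <- D) f (i, j) - g i)) <= e / 2.
  (* The successor keeps the denominator nonzero when B is empty. *)
  pose d := e / 2 / (#|` B|.+1)%:R.
  have d0 : 0 < d by rewrite divr_gt0.
  have dB : \sum_(i <- B) d <= e / 2.
    rewrite big_const_seq count_predT iter_addr_0 -[_ *+ _]mulr_natr /d -mulrA.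
    by rewrite ger_pMr// mulrC ler_pdivrMr// mul1r ler_nat.
  have : exists D0 : {fset J}, forall D : {fset J}, D0 `<=` D -> forall i,
      i \in enum_fset B -> normc (\sum_(j <- D) f (i, j) - g i) <= d.
    elim: (enum_fset B) => [|i r [D0 hD0]]; first by exists fset0.
    have [D1 hD1] := hg i _ d0; exists (D0 `|` D1)%fset => D.
    rewrite fsubUset => /andP[h0 h1] i'; rewrite inE => /predU1P[->|].
      exact: hD1.
    exact: hD0.
  move=> [D0 hD0]; exists D0 => D /hD0 h; apply: le_trans dB.
  apply: le_trans (le_normc_sum _ _) _.
  by rewrite big_seq [leRHS]big_seq ler_sum.
pose D := (D0 `|` [fset x.2 | x in A])%fset.
have h1 := hD0 D (fsubsetUl _ _).
have : normc (\sum_(p <- (B `*` D)%fset) f p - s) <= e / 2.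
  apply: hA; apply: fsubset_trans (fsub_fsetM A) _.
  apply/fsubsetP => x; rewrite !in_fsetM => /andP[x1 x2].
  by rewrite (fsubsetP AB)//= (fsubsetP (fsubsetUr _ _)).
rewrite big_fsetM => h2; rewrite sumrB in h1.
set X := \sum_(i <- B) \sum_(j <- D) _ in h1 h2.
have -> : \sum_(i <- B) g i - s = (X - s) - (X - \sum_(i <- B) g i) by ring.
by apply: le_trans (le_normcB _ _) _; rewrite (splitr e) lerD.
Qed.

Lemma is_sum_delta (R : realType) (I : choiceType) (i0 : I) (c : R[i]) :
  is_sum (fun i => if i == i0 then c else 0) c.
Proof.
move=> e e0; exists [fset i0] => B; rewrite fsub1set => hB.
rewrite (big_fsetD1 i0)//= eqxx big_seq big1 ?addr0 ?subrr ?normc0 ?ltW//.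
by move=> i; rewrite !inE => /andP[/negPf ->].
Qed.

Lemma summability_sumE (R : realType) (I : choiceType) (f : I -> R[i]) s :
  is_sum f s -> summability.sum (f : I -> R[i]^o) = s.
Proof.
move=> hs; have FF := @summability.totally_filter I.
have FF' : Filter (@summability.totally I) := @filter_filter _ _ FF.
apply: cvg_lim; first exact: norm_hausdorff.
apply/cvgrPdist_le => e e0.
(* Positivity in [R[i]] includes being real, so the estimate reduces to one in [R]. *)
have eR : e = (complex.Re e)%:C.
  by move: e0; rewrite ltcE/= => /andP[/eqP]; case: e => a b /= ->.
have e0' : 0 < complex.Re e by move: e0; rewrite ltcE => /andP[].
have [A hA] := hs _ e0'; exists A => // B /hA hB.
rewrite distrC /summability.partial_sum.
have -> : \sum_(i : B) f (val i) = \sum_(i <- B) f i by rewrite big_seq_fsetE.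
rewrite eR; change ((normc (\sum_(i <- B) f i - s))%:C <= (complex.Re e)%:C).
by rewrite lecR.
Qed.

(** * Sums over a lattice *)

(** The decay rate of the inverse of the lattice point of index l; the successor keeps it meaningful
    at index 0. *)
Definition wt (R : realType) (l : int * int) : R :=
  (`|l.1|%N + `|l.2|%N).+1%:R^-1.

Lemma wt_gt0 (R : realType) l : 0 < wt R l.
Proof. by rewrite invr_gt0. Qed.

Lemma wt_ge0 (R : realType) l : 0 <= wt R l.
Proof. exact: ltW (wt_gt0 R l). Qed.

Lemma wt_le1 (R : realType) l : wt R l <= 1.
Proof. by rewrite invf_le1// ler1n. Qed.

Lemma sum_int_le (R : realType) (g : nat -> R) (M : R) (B : {fset int}) :
  (forall k, 0 <= g k) -> (forall K, \sum_(k < K) g k <= M) ->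
  \sum_(n <- B) g `|n|%N <= 2 * M.
Proof.
move=> g0 gM.
have natle (D : {fset nat}) : \sum_(k <- D) g k <= M.
  apply: le_trans (gM (\sum_(k <- D) k).+1).
  pose n := (\sum_(k <- D) k).+1; rewrite -(big_mkord predT) /=.
  have -> : \sum_(0 <= i < n) g i = \sum_(i <- [fset i in iota 0 n]%fset) g i.
    apply: perm_big; apply: uniq_perm; rewrite ?iota_uniq ?fset_uniq// => x.
    by rewrite !inE.
  apply: ler_sum_fset => //; apply/fsubsetP => x xD.
  apply/imfsetP; exists x => //=.
  by rewrite -[_ \in _]/(x \in iota 0 n) mem_iota ltnS (big_fsetD1 x)//= leq_addr.
  have signle (P : pred int) : {in [pred n | P n] &, injective absz} ->
    \sum_(n <- B | P n) g `|n|%N <= M.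
  move=> hi; rewrite big_fset_condE/=.
  apply: le_trans (natle [fset `|n|%N | n in [fset i | i in B & P i]]%fset).
  rewrite [leRHS]big_imfset//=.
  move=> x y; rewrite !inE/= => /andP[_ Px] /andP[_ Py]; exact: hi.
rewrite (bigID (fun n : int => 0 <= n)) /= mulr_natl mulr2n lerD// signle//.
  by move=> x y; rewrite !inE; lia.
by move=> x y; rewrite !inE; lia.
Qed.

Lemma sum_inv2_le (R : realType) K :
  \sum_(k < K) ((k.+1%:R : R) * k.+2%:R)^-1 <= 1.
Proof.
suff -> : \sum_(k < K) ((k.+1%:R : R) * k.+2%:R)^-1 = 1 - K.+1%:R^-1.
  by rewrite gerBl invr_ge0.
elim: K => [|K IH]; first by rewrite big_ord0 invr1 subrr.
rewrite big_ord_recr/= IH -!natr1.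
have : (0 : R) <= K%:R by [].
by move: (K%:R : R) => a a0; field; apply/andP; split; lra.
Qed.

Lemma sum_inv3_le (R : realType) (M K : nat) :
  \sum_(k < K) ((M + k).+1%:R * (M + k).+2%:R * (M + k).+3%:R : R)^-1
    <= (M.+1%:R * M.+2%:R)^-1 / 2.
Proof.
suff -> : \sum_(k < K) ((M + k).+1%:R * (M + k).+2%:R * (M + k).+3%:R : R)^-1
   = ((M.+1%:R * M.+2%:R)^-1 - ((M + K).+1%:R * (M + K).+2%:R)^-1) / 2.
  by rewrite ler_pM2r// gerBl invr_ge0 mulr_ge0.
elim: K => [|K IH]; first by rewrite big_ord0 addn0 subrr mul0r.
rewrite big_ord_recr/= IH addnS -!natr1 !natrD.
have : (0 : R) <= K%:R by [].
have : (0 : R) <= M%:R by [].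
move: (K%:R : R) (M%:R : R) => a b b0 a0; field.
by repeat (apply/andP; split); apply: lt0r_neq0; lra.
Qed.

(** With b = |m| + |n|, the cube of the weight is at most 6 / ((b+1)(b+2)(b+3)), which telescopes in
    n and then in m. The constant is 6 * 2 * 1: the two signs of n cancel the 1/2 of [sum_inv3_le],
    and those of m give the factor 2. *)
Lemma wt3_abs_bounded (R : realType) :
  abs_bounded (fun l => (wt R l ^+ 3)%:C) 12.
Proof.
move=> D; apply: le_trans (ler_sum_fset (fun i => normc_ge0 _) (fsub_fsetM D)) _.
rewrite big_fsetM.
apply: (@le_trans _ _ (\sum_(i <- [fset x.1 | x in D]%fset)
    6 * (`|i|%N.+1%:R * `|i|%N.+2%:R)^-1)); last first.
  rewrite -mulr_sumr (_ : 12 = 6 * (2 * 1)); last by ring.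
  rewrite ler_pM2l//; apply: (sum_int_le (g := fun k => (k.+1%:R * k.+2%:R)^-1)).
    by move=> k; rewrite invr_ge0 mulr_ge0.
  exact: sum_inv2_le.
apply: ler_sum => m _.
have -> : 6 * (`|m|%N.+1%:R * `|m|%N.+2%:R)^-1 =
    2 * (6 * ((`|m|%N.+1%:R * `|m|%N.+2%:R)^-1 / 2)) :> R.
  by move: ((_ * _)^-1) => y; field.
pose g k : R := 6 * ((`|m| + k).+1%:R * (`|m| + k).+2%:R * (`|m| + k).+3%:R)^-1.
apply: le_trans (@sum_int_le R g _ [fset x.2 | x in D]%fset _ _); last 2 first.
- by move=> k; rewrite mulr_ge0// invr_ge0 !mulr_ge0.
- by move=> K; rewrite -mulr_sumr ler_pM2l// sum_inv3_le.
apply: ler_sum => n _; rewrite normc_real ger0_norm ?exprn_ge0 ?wt_ge0//.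
rewrite /wt /g /= exprVn ler_pdivlMr ?mulr_gt0// mulrC ler_pdivrMr ?exprn_gt0//.
rewrite -!natr1; have : (0 : R) <= (`|m| + `|n|)%:R by [].
move: (_%:R : R) => b b0; rewrite -subr_ge0.
rewrite (_ : _ - _ = (b + 1) * (5 * b * b + 7 * b)); last by ring.
by rewrite !(mulr_ge0, addr_ge0).
Qed.

Lemma wt3_summand_bounded (R : realType) (f : int * int -> R[i]) (K : R) :
  0 <= K -> (forall l, normc (f l) <= K * wt R l ^+ 3) ->
  abs_bounded f (K * 12).
Proof.
move=> K0 fK; apply: (le_abs_bounded K0 _ (@wt3_abs_bounded R)) => l.
by rewrite normc_real ger0_norm ?exprn_ge0 ?wt_ge0.
Qed.

(** Any finite set of integers lies in some [-K, K), over which the sum collapses to h (-K) - h K;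
    both terms are small for large K. *)
Lemma int_telescope (R : realType) (h : int -> R[i]) t :
  is_sum (fun m => h m - h (m + 1)) t ->
  (forall e : R, 0 < e -> exists N : nat, forall m : int, (N <= `|m|)%N ->
     normc (h m) <= e) -> t = 0.
Proof.
move=> ht hh; apply: eq0_normc; apply/eqP; rewrite eq_le normc_ge0 andbT.
apply/ler_addgt0Pr => e e0; rewrite add0r.
have e30 : 0 < e / 3 by rewrite divr_gt0.
have [A hA] := ht _ e30; have [N hN] := hh _ e30.
pose K := (N + \sum_(a <- A) `|a|%N.+1)%N.
have KA a : a \in A -> (`|a|%N < K)%N.
  by move=> aA; rewrite /K (big_fsetD1 a)//=; lia.
pose B := [fset (k%:Z - K%:Z) | k in iota 0 (K + K)]%fset.
have AB : (A `<=` B)%fset.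
  apply/fsubsetP => a aA; apply/imfsetP; exists (absz ((a : int) + K%:Z)) => /=.
    by rewrite -[_ \in _]/(_ \in iota 0 _) mem_iota; move: (KA a aA); lia.
  by move: (KA a aA); lia.
have tel n : \sum_(0 <= k < n) (h (k%:Z - K%:Z) - h (k%:Z - K%:Z + 1)) =
    h (- K%:Z) - h (n%:Z - K%:Z).
  elim: n => [|n IH]; first by rewrite big_geq// sub0r subrr.
  rewrite big_nat_recr//= IH addrA subrK; congr (_ - h _); lia.
have := hA B AB; rewrite big_imfset/=; last by move=> x y _ _; lia.
rewrite undup_id ?iota_uniq//.
have -> : \sum_(k <- iota 0 (K + K)) (h (k%:Z - K%:Z) - h (k%:Z - K%:Z + 1)) =
    h (- K%:Z) - h (K%:Z).
  have := tel (K + K)%N; rewrite /index_iota subn0 => ->; congr (_ - h _); lia.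
set x := h _; set y := h _ => h1.
have hx : normc x <= e / 3 by apply: hN; rewrite /K; lia.
have hy : normc y <= e / 3 by apply: hN; rewrite /K; lia.
have -> : t = x - y - (x - y - t) by ring.
apply: le_trans (le_normcB _ _) _.
have := le_normcB x y; lra.
Qed.

Lemma mul_mul_add_le (R : realType) (a b s : R) :
  0 <= a -> 0 <= b -> s <= a + b -> a * b * s <= 2 * (a ^+ 3 + b ^+ 3).
Proof.
move=> a0 b0 sab; apply: (@le_trans _ _ (a * b * (a + b))).
  by rewrite ler_wpM2l ?mulr_ge0.
rewrite -subr_ge0.
rewrite (_ : _ - _ = (a - b) ^+ 2 * (a + b) + a ^+ 3 + b ^+ 3); last by ring.
by rewrite !addr_ge0 ?exprn_ge0// mulr_ge0 ?sqr_ge0 ?addr_ge0.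
Qed.

Lemma abs_bounded_delta (R : realType) (I : choiceType) (i0 : I) :
  abs_bounded (fun i => if i == i0 then 1 else 0 : R[i]) 1.
Proof.
move=> B; have [hB|hB] := boolP (i0 \in B).
  rewrite (big_fsetD1 i0)//= eqxx normc1 big_seq big1 ?addr0//.
  by move=> i; rewrite !inE => /andP[/negPf ->]; rewrite normc0.
rewrite big_seq big1// => i iB; case: eqVneq => [ii0|]; last by rewrite normc0.
by move: hB; rewrite -ii0 iB.
Qed.

Lemma pairD (a b c d : int) : ((a, b) + (c, d) : int * int) = (a + c, b + d).
Proof. by []. Qed.

(** * Estimates, periodicity and the quadratic identity for a general lattice *)

Section Lattice.
Variables (R : realType) (w1 w2 : R[i]).
Hypothesis w12 : complex.Im (w2 / w1) != 0.

Definition lattice_pt (l : int * int) : R[i] := l.1%:~R * w1 + l.2%:~R * w2.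
Local Notation lam := lattice_pt.

Lemma lamD l r : lam (l + r) = lam l + lam r.
Proof. by rewrite /lam /= !intrD; ring. Qed.

Lemma lamN l : lam (- l) = - lam l.
Proof. by rewrite /lam /= !intrN; ring. Qed.

Lemma lam0 : lam 0 = 0.
Proof. by rewrite /lam /= !mul0r addr0. Qed.

(** After division by w1, the imaginary part of m + n (w2 / w1) controls n, and the triangle
    inequality then controls m. *)
Lemma lam_growth : exists c : R, 0 < c /\
  forall l, c * (`|l.1|%N + `|l.2|%N)%:R <= normc (lam l).
Proof.
have w10 : w1 != 0 by apply/eqP => h; move: w12; rewrite h invr0 mulr0 eqxx.
have tn0 := w12; set t := complex.Im _ in tn0; set T := normc (w2 / w1).
have T0 : 0 <= T := normc_ge0 _.
have t0 : 0 < `|t| by rewrite normr_gt0.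
pose D := 1 + (1 + T) / `|t|.
have D0 : 0 < D by rewrite addr_gt0// divr_gt0// ltr_wpDr.
exists (normc w1 / D); split; first by rewrite divr_gt0// normc_gt0.
move=> [m n] /=.
have -> : lam (m, n) = w1 * (m%:~R + n%:~R * (w2 / w1)) by rewrite /lam /=; field.
rewrite normcM -mulrA ler_wpM2l ?normc_ge0// mulrC ler_pdivrMr//.
set X := normc _.
have hn : `|n|%N%:R * `|t| <= X.
  apply: le_trans (normc_Im _); rewrite /t.
  have -> : complex.Im (m%:~R + n%:~R * (w2 / w1)) = n%:~R * complex.Im (w2 / w1) :> R.
    case: (w2 / w1) => a b; rewrite -!(rmorph_int (real_complex R)) /=; ring.
  by rewrite normrM -intr_norm -natr_absz.
have hm : `|m|%N%:R <= X + `|n|%N%:R * T.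
  have -> : `|m|%N%:R = normc (m%:~R : R[i]).
    by rewrite -(rmorph_int (real_complex R)) normc_real -intr_norm -natr_absz.
  have -> : `|n|%N%:R * T = normc (n%:~R * (w2 / w1)).
    by rewrite normcM -(rmorph_int (real_complex R)) normc_real -intr_norm -natr_absz.
  apply: le_trans (le_normcB _ _); by rewrite addrK.
rewrite natrD /D.
have hn' : `|n|%N%:R <= X / `|t| by rewrite ler_pdivlMr.
have : `|n|%N%:R * (1 + T) <= X / `|t| * (1 + T) by rewrite ler_wpM2r// addr_ge0.
rewrite (_ : X * (1 + _) = X + X / `|t| * (1 + T)); last by ring.
lra.
Qed.

(* As 0^-1 = 0, the inverse of lattice_pt 0 vanishes, so a sum over the nonzero
   points of a function of (lattice_pt l)^-1 without constant term can range over
   all indices. *)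
Definition inv_diff (z : R[i]) l := (z - lam l)^-1.
Local Notation u := inv_diff.

(** Outside a finite box of indices the lattice point dominates z. Inside the box the finitely many
    ratios are bounded by their sum; this covers even a z in the lattice, the inverse of 0 being
    0. *)
Lemma u_bound z : exists K : R, 0 < K /\ forall l, normc (u z l) <= K * wt R l.
Proof.
have [c [c0 hc]] := lam_growth.
pose X := 2 * normc z / c.
pose N := (Num.truncn X).+2.
have hN : X + 1 <= N%:R.
  by rewrite /N -natr1 lerD2r ltW// truncnS_gt.
pose r : seq int := [seq k%:Z | k <- iota 0 N] ++ [seq - k%:Z | k <- iota 0 N].
have hr (m : int) : (`|m| < N)%N -> m \in r.
  move=> hm; rewrite mem_cat; case: (leP 0 m) => m0; apply/orP; [left|right];
  by apply/mapP; exists `|m|%N; rewrite ?mem_iota//; lia.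
pose S := \sum_(l <- [seq (x, y) | x <- r, y <- r]) normc (u z l) / wt R l.
have tge (l : int * int) : 0 <= normc (u z l) / wt R l by rewrite divr_ge0 ?normc_ge0 ?wt_ge0.
have S0 : 0 <= S by rewrite sumr_ge0.
exists (2 / c + S); split; first by rewrite ltr_wpDr// divr_gt0.
move=> l; rewrite -ler_pdivrMr ?wt_gt0//.
have [hl|hl] := boolP (l \in [seq (x, y) | x <- r, y <- r]).
  rewrite /S (perm_big _ (perm_to_rem hl)) big_cons.
  rewrite addrCA lerDl addr_ge0 ?sumr_ge0// divr_ge0// ltW//.
have {hl} Nl : (N <= `|l.1| + `|l.2|)%N.
  rewrite leqNgt; apply: contra hl => hl; apply/allpairsP; exists l; split.
  - by apply: hr; apply: leq_ltn_trans hl; rewrite leq_addr.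
  - by apply: hr; apply: leq_ltn_trans hl; rewrite leq_addl.
  - by rewrite -surjective_pairing.
apply: (@le_trans _ _ (2 / c)); last by rewrite lerDl.
rewrite /wt invrK /u normcV -addn1 [(_ + 1)%:R]natrD.
set s : R := (_ + _)%:R.
have Ns : N%:R <= s by rewrite ler_nat.
have h1 : c * s <= normc (lam l) := hc l.
have h2 : normc (lam l) <= normc (z - lam l) + normc z.
  by rewrite normc_distrC -{1}(subrK z (lam l)) le_normcD.
have h3 : 2 * normc z + c <= c * s.
  have : c * (X + 1) <= c * s by rewrite ler_pM2l// (le_trans hN).
  by rewrite (_ : c * (X + 1) = 2 * normc z + c)// /X; field; rewrite gt_eqF.
have z0 := normc_ge0 z.
have h4 : c * (s + 1) <= 2 * normc (z - lam l) by lra.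
have s0 : 0 <= s by [].
have h5 : 0 < normc (z - lam l).
  by rewrite -(pmulr_rgt0 _ (ltr0n R 2)) (lt_le_trans _ h4)// mulr_gt0// ltr_wpDl.
by rewrite mulrC ler_pdivrMr// mulrAC ler_pdivlMr// mulrC.
Qed.

Definition unordered_sum (f : int * int -> R[i]) : R[i] := xget 0 [set s | is_sum f s].
Local Notation total := unordered_sum.

Lemma totalP f s : is_sum f s -> is_sum f (total f).
Proof. by move=> h; rewrite /total; case: xgetP => [x -> //|/(_ s)]. Qed.

(** S_k, the Weierstrass function P and the Eisenstein sums G_k. The term of index 0 in [wp_sum] is
    z^-2, since the inverse of the lattice point 0 is 0. *)
Definition eis_sum z k := total (fun l => u z l ^+ k).
Local Notation S := eis_sum.
Definition wp_sum z := total (fun l => u z l ^+ 2 - (lam l)^-1 ^+ 2).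
Local Notation wp := wp_sum.
Definition eis_coef k := total (fun l => (lam l)^-1 ^+ k).
Local Notation G := eis_coef.

Lemma u0E l : u 0 l = - (lam l)^-1.
Proof. by rewrite /u sub0r invrN. Qed.

Lemma ilam_bound : exists K : R, 0 < K /\ forall l, normc (lam l)^-1 <= K * wt R l.
Proof.
by have [K [K0 hK]] := u_bound 0; exists K; split=> // l; rewrite -normcN -u0E.
Qed.

Lemma powX_bound (v : int * int -> R[i]) (K : R) k :
  0 <= K -> (forall l, normc (v l) <= K * wt R l) -> (3 <= k)%N ->
  forall l, normc (v l ^+ k) <= K ^+ k * wt R l ^+ 3.
Proof.
move=> K0 hv k3 l; rewrite normcX.
apply: (@le_trans _ _ ((K * wt R l) ^+ k)).
  by rewrite lerXn2r ?nnegrE ?normc_ge0 ?mulr_ge0 ?wt_ge0.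
rewrite exprMn ler_wpM2l ?exprn_ge0//.
by apply: ler_wiXn2l k3; rewrite ?wt_ge0 ?wt_le1.
Qed.

Lemma u_abs_bounded z k : (3 <= k)%N -> exists M, abs_bounded (fun l => u z l ^+ k) M.
Proof.
move=> k3; have [K [K0 hK]] := u_bound z; exists (K ^+ k * 12).
by apply: wt3_summand_bounded (powX_bound (ltW K0) hK k3); rewrite exprn_ge0 ?ltW.
Qed.

Lemma ilam_abs_bounded k : (3 <= k)%N -> exists M, abs_bounded (fun l => (lam l)^-1 ^+ k) M.
Proof.
move=> k3; have [K [K0 hK]] := ilam_bound; exists (K ^+ k * 12).
by apply: wt3_summand_bounded (powX_bound (ltW K0) hK k3); rewrite exprn_ge0 ?ltW.
Qed.

Lemma is_sum_S z k : (3 <= k)%N -> is_sum (fun l => u z l ^+ k) (S z k).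
Proof.
by move=> /(u_abs_bounded z)[M /abs_bounded_is_sum[s]]; exact: totalP.
Qed.

Lemma is_sum_G k : (3 <= k)%N -> is_sum (fun l => (lam l)^-1 ^+ k) (G k).
Proof.
by move=> /ilam_abs_bounded[M /abs_bounded_is_sum[s]]; exact: totalP.
Qed.

Lemma lam_eq0 l : (lam l == 0) = (l == 0).
Proof.
apply/eqP/eqP => [h|->]; last exact: lam0.
have [c [c0 hc]] := lam_growth; have := hc l; rewrite h normc0 pmulr_rle0// lern0.
by case: l {h} => a b /=; rewrite addn_eq0 !absz_eq0 => /andP[/eqP -> /eqP ->].
Qed.

Definition regular z := forall l, z != lam l.

Lemma is_sum_wp z : regular z -> is_sum (fun l => u z l ^+ 2 - (lam l)^-1 ^+ 2) (wp z).
Proof.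
move=> zL; suff [M /abs_bounded_is_sum[s]] : exists M, abs_bounded (fun l => u z l ^+ 2 - (lam l)^-1 ^+ 2) M.
  exact: totalP.
have [K [K0 hK]] := u_bound z; have [K' [K'0 hK']] := ilam_bound.
(* With b the inverse of the lattice point, u^2 - b^2 = z u b (u - b) is of third order and gives
   the first summand of C. The second one covers index 0. *)
pose C := normc z * (K * K' * (K + K')) + K ^+ 2.
exists (C * 12); apply: wt3_summand_bounded => [|l].
  by rewrite addr_ge0 ?mulr_ge0 ?normc_ge0 ?exprn_ge0 ?addr_ge0 ?(ltW K0) ?(ltW K'0).
have wl := wt_ge0 R l; have ul := hK l; have bl := hK' l.
have un := normc_ge0 (u z l); have bn := normc_ge0 (lam l)^-1.
rewrite mulrDl; have [->|l0] := eqVneq l 0.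
  rewrite lam0 invr0 expr0n/= subr0 -[leLHS]add0r lerD//.
    by rewrite !mulr_ge0 ?normc_ge0 ?exprn_ge0 ?addr_ge0 ?wt_ge0 ?(ltW K0) ?(ltW K'0).
  have -> : wt R 0 = 1 by rewrite /wt/= invr1.
  rewrite expr1n mulr1 normcX; have := hK 0.
  rewrite /wt /= invr1 mulr1 => h.
  by rewrite lerXn2r ?nnegrE ?normc_ge0 ?(ltW K0) ?(ltW K'0).
rewrite -[leLHS]addr0 lerD ?mulr_ge0 ?exprn_ge0 ?(ltW K0) ?(ltW K'0)//.
have lam_n0 : lam l != 0 by rewrite lam_eq0.
have -> : u z l ^+ 2 - (lam l)^-1 ^+ 2 = z * (u z l * (lam l)^-1 * (u z l - (lam l)^-1)).
  by rewrite /u; field; rewrite lam_n0 subr_eq0 zL.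
rewrite !normcM -[leRHS]mulrA ler_wpM2l ?normc_ge0//.
have -> : K * K' * (K + K') * wt R l ^+ 3 =
  (K * wt R l) * (K' * wt R l) * (K * wt R l + K' * wt R l) by ring.
apply: ler_pM; rewrite ?mulr_ge0 ?normc_ge0//; first exact: ler_pM.
by apply: le_trans (le_normcB _ _) _; exact: lerD.
Qed.

Lemma is_sum_shift (v : int * int -> R[i]) s r :
  is_sum v s -> is_sum (fun l => v (l + r)) s.
Proof. by apply: (is_sum_reindex (h' := fun l => l - r)) => l; rewrite ?addrK ?subrK. Qed.

Lemma is_sum_opp (v : int * int -> R[i]) s :
  is_sum v s -> is_sum (fun l => v (- l)) s.
Proof. by apply: (is_sum_reindex (h' := fun l => - l)) => l; rewrite opprK. Qed.

Lemma abs_bounded_shift (v : int * int -> R[i]) M r :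
  abs_bounded v M -> abs_bounded (fun l => v (l + r)) M.
Proof. by apply: abs_bounded_reindex; exact: addIr. Qed.

(* For the two basic shifts the sum telescopes along lines; the shifts r with sum 0
   form a group. *)
Lemma shift_sum (f : int * int -> R[i]) (K : R) :
  0 < K -> (forall l, normc (f l) <= K * wt R l) ->
  (forall r, exists M, abs_bounded (fun l => f l - f (l + r)) M) ->
  forall r, is_sum (fun l => f l - f (l + r)) 0.
Proof.
move=> K0 fK fM.
have fsmall (g : int -> int * int) : (forall m, `|m| <= `|(g m).1| + `|(g m).2|)%N ->
    forall e : R, 0 < e -> exists N : nat, forall m : int, (N <= `|m|)%N ->
    normc (f (g m)) <= e.
  move=> hg e e0; exists (Num.truncn (K / e)) => m hm.
  apply: le_trans (fK _) _; rewrite /wt ler_pdivrMr// mulrC -ler_pdivrMr//.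
  apply: ltW; apply: lt_le_trans (truncnS_gt _) _; rewrite ler_nat ltnS.
  exact: leq_trans hm (hg m).
have e1 : is_sum (fun l => f l - f (l + (1, 0))) 0.
  have [M hM] := fM (1, 0); have [s hs] := abs_bounded_is_sum hM.
  have line n : is_sum (fun m => f (m, n) - f (m + 1, n)) 0.
    have inj : injective (fun m : int => (m, n)) by move=> x y [].
    have /abs_bounded_is_sum[t ht] := abs_bounded_reindex inj hM.
    have {}ht : is_sum (fun m => f (m, n) - f (m + 1, n)) t.
      by apply: eq_is_sum ht => m /=; rewrite pairD addr0.
    rewrite -[X in is_sum _ X](int_telescope (h := fun m => f (m, n)) ht) => //.
    by apply: fsmall => m /=; rewrite leq_addr.
  suff : s = 0 by move=> <-.
  pose sw (p : int * int) := (p.2, p.1).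
  have hs' : is_sum ((fun l => f l - f (l + (1, 0))) \o sw) s.
    by apply: (is_sum_reindex (h' := sw)) hs => -[].
  apply: (is_sum_unique _ (@is_sum0 R int)); apply: (is_sum_fubini hs') => n.
  by apply: eq_is_sum (line n) => m /=; rewrite pairD addr0.
have e2 : is_sum (fun l => f l - f (l + (0, 1))) 0.
  have [M hM] := fM (0, 1); have [s hs] := abs_bounded_is_sum hM.
  have line m : is_sum (fun n => f (m, n) - f (m, n + 1)) 0.
    have inj : injective (fun n : int => (m, n)) by move=> x y [].
    have /abs_bounded_is_sum[t ht] := abs_bounded_reindex inj hM.
    have {}ht : is_sum (fun n => f (m, n) - f (m, n + 1)) t.
      by apply: eq_is_sum ht => n /=; rewrite pairD addr0.
    rewrite -[X in is_sum _ X](int_telescope (h := fun n => f (m, n)) ht) => //.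
    by apply: fsmall => n /=; rewrite leq_addl.
  suff : s = 0 by move=> <-.
  apply: (is_sum_unique _ (@is_sum0 R int)); apply: (is_sum_fubini hs) => m.
  by apply: eq_is_sum (line m) => n /=; rewrite pairD addr0.
pose P r := is_sum (fun l => f l - f (l + r)) 0.
have P0 : P 0 by apply: eq_is_sum (@is_sum0 _ _) => l; rewrite addr0 subrr.
have PD r s : P r -> P s -> P (r + s).
  move=> hr /(is_sum_shift r) hs; have := is_sumD hr hs; rewrite addr0.
  by apply: eq_is_sum => l; rewrite (addrA l r s); ring.
have PN r : P r -> P (- r).
  move=> /(is_sum_shift (- r)) /is_sumN; rewrite oppr0.
  by apply: eq_is_sum => l; rewrite subrK opprB.
have Pn r n : P r -> P (r *+ n).
  by move=> hr; elim: n => [|n IH]; rewrite ?mulr0n// mulrS; exact: PD.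
have Pz r (n : int) : P r -> P (r *~ n).
  by case: n => n hr; [exact: Pn|apply: PN; exact: Pn].
move=> [a b]; have -> : (a, b) = (1, 0) *~ a + (0, 1) *~ b.
  have hn (c d : int) k : ((c, d) : int * int) *+ k = (c *+ k, d *+ k).
    by elim: k => [|k IH]; rewrite ?mulr0n// !mulrS IH pairD.
  have hz (c d n : int) : ((c, d) : int * int) *~ n = (c *~ n, d *~ n).
    by case: n => k; rewrite /intmul hn.
  have h1 (n : int) : ((1, 0) : int * int) *~ n = (n, 0) by rewrite hz mul0rz intz.
  have h2 (n : int) : ((0, 1) : int * int) *~ n = (0, n) by rewrite hz mul0rz intz.
  by rewrite h1 h2 pairD addr0 add0r.
exact: PD (Pz _ _ e1) (Pz _ _ e2).
Qed.

Lemma regular_shift z r : regular z -> regular (z + lam r).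
Proof.
move=> zL l; have := zL (l - r); rewrite lamD lamN.
by apply: contraNneq => <-; rewrite addrK.
Qed.

Lemma u_shift z l r : u (z + lam r) (l + r) = u z l.
Proof. by rewrite /u lamD; congr (_^-1); ring. Qed.

Lemma S_shift z r k : (3 <= k)%N -> S (z + lam r) k = S z k.
Proof.
move=> k3; apply/esym/(is_sum_unique (is_sum_S z k3)).
by apply: eq_is_sum (is_sum_shift r (is_sum_S (z + lam r) k3)) => l; rewrite u_shift.
Qed.

Lemma S_opp z k : (3 <= k)%N -> S (- z) k = (- 1) ^+ k * S z k.
Proof.
move=> k3; apply: (is_sum_unique (is_sum_S (- z) k3)).
apply: eq_is_sum (is_sumZ ((- 1) ^+ k) (is_sum_opp (is_sum_S z k3))) => l.
by rewrite -exprMn /u lamN mulN1r -invrN; congr ((_^-1) ^+ _); ring.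
Qed.

Lemma wp_opp z : regular z -> wp (- z) = wp z.
Proof.
move=> zL; have zL' : regular (- z).
  by move=> l; have := zL (- l); rewrite lamN eqr_oppLR.
apply: (is_sum_unique (is_sum_wp zL')).
apply: eq_is_sum (is_sum_opp (is_sum_wp zL)) => l.
rewrite /u lamN !invrN !sqrrN; congr (_ - _).
by rewrite -[RHS]sqrrN -invrN; congr (_^-1 ^+ _); ring.
Qed.

Lemma u_diff z l r : regular z -> u z l - u z (l + r) = - lam r * (u z l * u z (l + r)).
Proof.
move=> zL; rewrite /u lamD; field.
by rewrite !subr_eq0 -lamD !zL.
Qed.

(** The squares alone are not absolutely summable, but by [u_diff] the difference of a square and
    its shift is of third order, so that [shift_sum] applies. *)
Lemma u2_shift_sum z r : regular z ->
  is_sum (fun l => u z l ^+ 2 - u z (l + r) ^+ 2) 0.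
Proof.
move=> zL; have [K [K0 hK]] := u_bound z.
apply: (@shift_sum (fun l => u z l ^+ 2) (K ^+ 2)) => {r}; first by rewrite exprn_gt0.
  move=> l; rewrite normcX; apply: (@le_trans _ _ ((K * wt R l) ^+ 2)).
    by rewrite lerXn2r ?nnegrE ?normc_ge0 ?mulr_ge0 ?wt_ge0 ?(ltW K0).
  rewrite exprMn ler_wpM2l ?exprn_ge0 ?(ltW K0)// -[leRHS]expr1.
  by rewrite ler_wiXn2l ?wt_ge0 ?wt_le1.
move=> r; have [M hM] := @u_abs_bounded z 3 isT.
pose B := normc (lam r) * 2.
exists (B * (M + M)).
have B0 : 0 <= B by rewrite mulr_ge0 ?normc_ge0.
have hMr := abs_bounded_shift r hM.
apply: (le_abs_boundedD B0 _ hM hMr) => l.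
rewrite subr_sqr u_diff// !normcX !normcM normcN /B -!mulrA ler_wpM2l ?normc_ge0//.
by rewrite mulrA mul_mul_add_le ?normc_ge0 ?le_normcD.
Qed.

Lemma wp_shift z r : regular z -> wp (z + lam r) = wp z.
Proof.
move=> zL; have zL' := regular_shift r zL.
have h := is_sumB (is_sum_wp zL) (is_sum_wp zL').
apply/esym/eqP; rewrite -subr_eq0; apply/eqP; apply: is_sum_unique h _.
apply: eq_is_sum (u2_shift_sum (- r) zL) => l.
by rewrite -(u_shift z (l - r) r) subrK; ring.
Qed.

Lemma G_odd k : (3 <= k)%N -> odd k -> G k = 0.
Proof.
move=> k3 ko; have h := is_sum_G k3.
have h' : is_sum (fun l => (lam l)^-1 ^+ k) (- G k).
  apply: eq_is_sum (is_sumN (is_sum_opp h)) => l.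
  by rewrite lamN invrN exprNn -signr_odd ko expr1 mulN1r opprK.
have /eqP := is_sum_unique h h'; rewrite -addr_eq0 -mulr2n -mulr_natr mulf_eq0.
by rewrite pnatr_eq0 orbF => /eqP.
Qed.

Lemma key z : regular z -> 5 * S z 6 = 2 * S z 3 ^+ 2 + 3 * (wp z * S z 4).
Proof.
move=> zL.
(* The right side of the partial fraction identity. The last term extends it to r = 0, where the
   other terms vanish and the left side is 5 u^6. *)
pose F (p : (int * int) * (int * int)) : R[i] :=
  4 * ((lam p.2)^-1 ^+ 3 * u z p.1 ^+ 3) + 2 * ((lam p.2)^-1 ^+ 3 * u z (p.1 + p.2) ^+ 3)
  + 3 * ((lam p.2)^-1 ^+ 4 * (u z p.1 ^+ 2 - u z (p.1 + p.2) ^+ 2))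
  + 5 * (if p.2 == 0 then u z p.1 ^+ 6 else 0).
have FE l r : F (l, r) = 3 * u z l ^+ 4 * (u z (l + r) ^+ 2 - (lam r)^-1 ^+ 2)
                         + 2 * u z l ^+ 3 * u z (l + r) ^+ 3.
  rewrite /F /=; case: eqVneq => [->|r0].
    by rewrite lam0 invr0 !expr0n/= addr0; ring.
  have l0 : lam r != 0 by rewrite lam_eq0.
  rewrite /u lamD; field; rewrite l0 /= !subr_eq0 -lamD.
  by rewrite !zL.
have [M hM] := @u_abs_bounded z 3 isT.
have [N hN] := @ilam_abs_bounded 3 isT.
have [M6 hM6] := @u_abs_bounded z 6 isT.
have b1 := abs_bounded_mul hM hN.
pose sh (p : (int * int) * (int * int)) := (p.1 + p.2, p.2).
have shK : injective sh.
  by apply: (can_inj (g := fun p => (p.1 - p.2, p.2))) => -[a b]; rewrite /sh /= addrK.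
have b2 := abs_bounded_reindex shK b1.
have b3 : exists P, abs_bounded (fun p : (int * int) * (int * int) =>
    (lam p.2)^-1 ^+ 4 * (u z p.1 ^+ 2 - u z (p.1 + p.2) ^+ 2)) P.
  exists (2 * (M * N + M * N)).
  apply: (le_abs_boundedD _ _ b1 b2) => // -[l r] /=.
  have [->|r0] := eqVneq r 0.
    by rewrite lam0 invr0 expr0n/= mul0r normc0 mulr_ge0 ?addr_ge0 ?normc_ge0.
  have l0 : lam r != 0 by rewrite lam_eq0.
  have -> : (lam r)^-1 ^+ 4 * (u z l ^+ 2 - u z (l + r) ^+ 2) =
      - ((lam r)^-1 ^+ 3 * (u z l * u z (l + r) * (u z l + u z (l + r)))).
    by rewrite subr_sqr u_diff//; field.
  rewrite normcN !(normcM (_ ^+ 3)) !normcX !normcM -mulrDl mulrC [leRHS]mulrA.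
  by rewrite ler_wpM2r ?exprn_ge0 ?normc_ge0// mul_mul_add_le ?normc_ge0 ?le_normcD.
have b4 := abs_bounded_mul hM6 (@abs_bounded_delta R (int * int)%type 0).
have [T hT] : exists T, is_sum F T.
  have [t1 h1] := abs_bounded_is_sum b1.
  have [t2 h2] := abs_bounded_is_sum b2.
  have [P hP] := b3; have [t3 h3] := abs_bounded_is_sum hP.
  have [t4 h4] := abs_bounded_is_sum b4.
  exists (4 * t1 + 2 * t2 + 3 * t3 + 5 * t4).
  apply: eq_is_sum (is_sumD (is_sumD (is_sumD (is_sumZ 4 h1) (is_sumZ 2 h2)) (is_sumZ 3 h3)) (is_sumZ 5 h4)).
  move=> [l r]; rewrite /F /= ![u z _ ^+ 3 * _]mulrC; congr (_ + 5 * _).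
  by case: eqP => _; rewrite ?mulr1 ?mulr0.
(* For fixed l the sum over r yields P and S_3 at z - lam l, which equal their values at z by
   periodicity. *)
have out1 : is_sum (fun l => 3 * u z l ^+ 4 * wp z + 2 * u z l ^+ 3 * S z 3) T.
  apply: is_sum_fubini hT _ => l.
  have zl : regular (z - lam l) by rewrite -lamN; exact: regular_shift.
  have h1 := is_sum_wp zl; rewrite -lamN wp_shift// lamN in h1.
  have h2 := is_sum_S (z - lam l) (isT : (3 <= 3)%N).
  rewrite -lamN S_shift// lamN in h2.
  apply: eq_is_sum (is_sumD (is_sumZ (3 * u z l ^+ 4) h1) (is_sumZ (2 * u z l ^+ 3) h2)) => r.
  by rewrite FE; have -> : u (z - lam l) r = u z (l + r) by rewrite /u lamD; congr (_^-1); ring.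
have g3 := is_sum_G (isT : (3 <= 3)%N); rewrite G_odd// in g3.
have h3 := is_sum_S z (isT : (3 <= 3)%N).
have h4 := is_sum_S z (isT : (3 <= 4)%N).
have h6 := is_sum_S z (isT : (3 <= 6)%N).
have TE : T = 3 * wp z * S z 4 + 2 * S z 3 * S z 3.
  apply: is_sum_unique out1 _.
  by apply: eq_is_sum (is_sumD (is_sumZ (3 * wp z) h4) (is_sumZ (2 * S z 3) h3)) => l; ring.
pose sw (p : (int * int) * (int * int)) := (p.2, p.1).
have hT' : is_sum (F \o sw) T by apply: (is_sum_reindex (h' := sw)) hT => -[].
(* For fixed r both cubes sum to S_3 and the squares cancel by [u2_shift_sum]. The remaining
   multiple of the inverse cube of lam r disappears in the sum over r because G_3 = 0. *)
have out2 : is_sum (fun r => 6 * S z 3 * (lam r)^-1 ^+ 3 + 5 * (if r == 0 then S z 6 else 0)) T.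
  apply: is_sum_fubini hT' _ => r.
  have h3r := is_sum_shift r h3.
  have hd : is_sum (fun l => if r == 0 then u z l ^+ 6 else 0) (if r == 0 then S z 6 else 0).
    by case: eqP => // _; exact: is_sum0.
  have := is_sumD (is_sumD (is_sumD (is_sumZ (4 * (lam r)^-1 ^+ 3) h3) (is_sumZ (2 * (lam r)^-1 ^+ 3) h3r))
     (is_sumZ (3 * (lam r)^-1 ^+ 4) (u2_shift_sum r zL))) (is_sumZ 5 hd).
  rewrite (_ : _ * S z 3 + _ + _ + _ = 6 * S z 3 * (lam r)^-1 ^+ 3 + 5 * (if r == 0 then S z 6 else 0)); last by ring.
  by apply: eq_is_sum => l; rewrite /F /= !mulrA.
have TE' : T = 6 * S z 3 * 0 + 5 * S z 6.
  apply: is_sum_unique out2 _.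
  by apply: is_sumD (is_sumZ (6 * S z 3) g3) (is_sumZ 5 _); exact: is_sum_delta.
by rewrite mulr0 add0r in TE'; rewrite -TE' TE; ring.
Qed.
End Lattice.

(** * Taylor and Laurent expansions of the lattice sums *)

Section Lattice.
Variables (R : realType) (w1 w2 : R[i]).
Hypothesis w12 : complex.Im (w2 / w1) != 0.
Local Notation lam := (lattice_pt w1 w2).
Local Notation u := (inv_diff w1 w2).
Local Notation S := (eis_sum w1 w2).
Local Notation wp := (wp_sum w1 w2).
Local Notation G := (eis_coef w1 w2).
Local Notation regular := (regular w1 w2).

(** Here p and q stand for the inverses of z + h - l and z - l. The factor k^2 survives the
    induction because k^2 + (k + 1) <= (k + 1)^2. *)
Lemma pow_taylor (p q h : R[i]) (W : R) k : p - q = - (h * (p * q)) ->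
  normc p <= W -> normc q <= W ->
  normc (p ^+ k - q ^+ k + k%:R * h * q ^+ k.+1) <=
    normc h ^+ 2 * (k%:R ^+ 2 * W ^+ k.+2).
Proof.
move=> pq pW qW; have W0 := le_trans (normc_ge0 p) pW.
elim: k => [|k IH].
  by rewrite !expr0 subrr mul0r mul0r addr0 normc0 expr0n/= mul0r mulr0.
have -> : p ^+ k.+1 - q ^+ k.+1 + k.+1%:R * h * q ^+ k.+2 =
    p * (p ^+ k - q ^+ k + k%:R * h * q ^+ k.+1)
    + h ^+ 2 * (k.+1%:R * (p * q ^+ k.+2)).
  have e0 : p - q + h * (p * q) = 0 by rewrite pq addNr.
  rewrite -natr1 -[RHS]addr0.
  (* Adding this multiple of the relation between p and q leaves a polynomial identity. *)
  have <- : q ^+ k * (1 - (k%:R + 1) * h * q) * (p - q + h * (p * q)) = 0 by rewrite e0 mulr0.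
  by rewrite [h ^+ 2]expr2 !exprS; ring.
apply: le_trans (le_normcD _ _) _.
have hk : normc (h ^+ 2 * (k.+1%:R * (p * q ^+ k.+2))) <= normc h ^+ 2 * (k.+1%:R * W ^+ k.+3).
  rewrite normcM normcX ler_wpM2l ?exprn_ge0 ?normc_ge0// normcM.
  rewrite -(rmorph_nat (real_complex R)) normc_real ger0_norm// ler_wpM2l// normcM normcX (exprS W).
  by rewrite ler_pM ?normc_ge0 ?exprn_ge0 ?normc_ge0// lerXn2r ?nnegrE ?normc_ge0.
have hp : normc (p * (p ^+ k - q ^+ k + k%:R * h * q ^+ k.+1)) <=
    normc h ^+ 2 * (k%:R ^+ 2 * W ^+ k.+3).
  rewrite normcM; apply: (@le_trans _ _ (W * (normc h ^+ 2 * (k%:R ^+ 2 * W ^+ k.+2)))).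
    by rewrite ler_pM ?normc_ge0.
  by rewrite (exprS W k.+2) le_eqVlt; apply/orP; left; apply/eqP; ring.
apply: le_trans (lerD hp hk) _; rewrite -mulrDr ler_wpM2l ?exprn_ge0 ?normc_ge0//.
rewrite -mulrDl ler_wpM2r ?exprn_ge0//.
rewrite -!natrX -natrD ler_nat; lia.
Qed.

(** One radius serves all l: every lattice point is at distance at least 1 / K from z, so an h of
    modulus at most 1 / (2 K) at most halves that distance. The remainder has weight exponent k + 2
    >= 3 and can be summed. *)
Lemma u_taylor z k : regular z -> (1 <= k)%N ->
  exists d M : R, [/\ 0 < d, 0 <= M & forall h, normc h <= d -> forall l,
    normc (u (z + h) l ^+ k - u z l ^+ k + k%:R * h * u z l ^+ k.+1)
      <= normc h ^+ 2 * M * wt R l ^+ 3].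
Proof.
move=> zL k1; have [K [K0 hK]] := u_bound w12 z.
have K2 : 0 < 2 * K by rewrite mulr_gt0.
exists (2 * K)^-1, (k%:R ^+ 2 * (2 * K) ^+ k.+2); split; first by rewrite invr_gt0.
  by rewrite mulr_ge0 ?exprn_ge0 ?(ltW K2).
move=> h hd l.
have zl : z - lam l != 0 by rewrite subr_eq0 zL.
have nz : 0 < normc (z - lam l) by rewrite normc_gt0.
have ul : (normc (z - lam l))^-1 <= K * wt R l by rewrite -normcV; exact: hK.
have w0 := wt_gt0 R l; have w1' := wt_le1 R l.
have hh : normc h <= normc (z - lam l) / 2.
  apply: le_trans hd _; rewrite invfM mulrC ler_pM2r ?invr_gt0//.
  rewrite -[leRHS]invrK lef_pV2 ?posrE ?invr_gt0//.
  by apply: le_trans ul _; rewrite ler_piMr ?(ltW K0).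
have zh : normc (z - lam l) / 2 <= normc (z + h - lam l).
  have := le_normcB (z + h - lam l) h.
  rewrite (_ : z + h - lam l - h = z - lam l); last by ring.
  lra.
have zhl : z + h - lam l != 0 by rewrite -normc_gt0 (lt_le_trans _ zh)// divr_gt0.
have hp : normc (u (z + h) l) <= 2 * K * wt R l.
  rewrite /u normcV -mulrA; apply: le_trans (ler_wpM2l _ ul) => //.
  by rewrite -[2]invrK -invfM lef_pV2 ?posrE ?mulr_gt0 ?invr_gt0 ?normc_gt0// mulrC.
have hq : normc (u z l) <= 2 * K * wt R l.
  apply: le_trans (hK l) _; rewrite -mulrA ler_peMl ?mulr_ge0 ?(ltW K0) ?(ltW w0)//.
  by rewrite ler1n.
apply: le_trans (pow_taylor k _ hp hq) _.
  by rewrite /u; field; rewrite zl zhl.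
rewrite -[leRHS]mulrA ler_wpM2l ?exprn_ge0 ?normc_ge0//.
rewrite -[leRHS]mulrA ler_wpM2l ?exprn_ge0// exprMn ler_wpM2l ?exprn_ge0 ?(ltW K2)//.
by rewrite ler_wiXn2l ?(ltW w0).
Qed.

Lemma S_taylor z k : regular z -> (3 <= k)%N ->
  exists d M : R, 0 < d /\ forall h, normc h <= d ->
    normc (S (z + h) k - S z k + k%:R * h * S z k.+1) <= M * normc h ^+ 2.
Proof.
move=> zL k3; have [d [M [d0 M0 hM]]] := u_taylor zL (ltnW (ltnW k3)).
exists d, (M * 12); split=> // h hd.
have hs := is_sumD (is_sumB (is_sum_S w12 (z + h) k3) (is_sum_S w12 z k3))
  (is_sumZ (k%:R * h) (is_sum_S w12 z (leqW k3))).
have -> : M * 12 * normc h ^+ 2 = normc h ^+ 2 * M * 12 by ring.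
apply: is_sum_norm hs _; apply: wt3_summand_bounded (hM h hd).
by rewrite mulr_ge0 ?exprn_ge0 ?normc_ge0.
Qed.

Lemma wp_taylor z : regular z ->
  exists d M : R, 0 < d /\ forall h, normc h <= d -> regular (z + h) ->
    normc (wp (z + h) - wp z + 2 * h * S z 3) <= M * normc h ^+ 2.
Proof.
move=> zL; have [d [M [d0 M0 hM]]] := @u_taylor z 2 zL isT.
exists d, (M * 12); split=> // h hd zhL.
have hs := is_sumD (is_sumB (is_sum_wp w12 zhL) (is_sum_wp w12 zL))
  (is_sumZ (2 * h) (is_sum_S w12 z (isT : (3 <= 3)%N))).
have -> : M * 12 * normc h ^+ 2 = normc h ^+ 2 * M * 12 by ring.
apply: is_sum_norm hs _; apply: wt3_summand_bounded => [|l].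
  by rewrite mulr_ge0 ?exprn_ge0 ?normc_ge0.
by apply: le_trans (hM h hd l); rewrite opprB addrA subrK.
Qed.

Lemma lam_small : exists K : R, [/\ 0 < K, forall l, normc (lam l)^-1 <= K * wt R l &
  forall x : R[i], normc x <= (2 * K)^-1 -> forall l,
    normc (x * (lam l)^-1) <= 1 / 2 ].
Proof.
have [K [K0 hK]] := ilam_bound w12; exists K; split=> // x hx l.
rewrite normcM; apply: (@le_trans _ _ ((2 * K)^-1 * K)).
  rewrite ler_pM ?normc_ge0//; apply: le_trans (hK l) _.
  by rewrite ler_piMr ?wt_le1 ?(ltW K0).
by rewrite le_eqVlt; apply/orP; left; apply/eqP; field; rewrite gt_eqF.
Qed.

Lemma inv1B_le2 (t : R[i]) : normc t <= 1 / 2 -> 1 - t != 0 /\ normc (1 - t)^-1 <= 2.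
Proof.
move=> ht; have := le_normcD (1 - t) t; rewrite subrK normc1 => h.
have h2 : 2^-1 <= normc (1 - t) by lra.
have h0 : 0 < normc (1 - t) by apply: lt_le_trans h2; rewrite invr_gt0.
split; first by rewrite -normc_gt0.
by rewrite normcV -[2]invrK lef_pV2 ?posrE ?invr_gt0.
Qed.

(** With t = x / l, the tail of (1 - t)^-2 from t^5 on is t^5 (6 - 5 t) / (1 - t)^2, and that of (1
    - t)^-3 from t^4 on is t^4 (15 - 24 t + 10 t^2) / (1 - t)^3. The coefficients G_3 and G_5 vanish
    by oddness. *)
Lemma wp_expansion : exists d M : R, 0 < d /\ forall x, normc x <= d -> regular x ->
  normc (wp x - (x ^- 2 + 3 * x ^+ 2 * G 4 + 5 * x ^+ 4 * G 6)) <= M * normc x ^+ 5 /\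
  normc (S x 3 - (x ^- 3 - 3 * x * G 4 - 10 * x ^+ 3 * G 6)) <= M * normc x ^+ 4.
Proof.
have [K [K0 hK hx]] := lam_small.
(* For |t| <= 1/2 the two tail factors are at most 10 * 2^2 and 30 * 2^3, both below 300. *)
pose M := 300 * (K ^+ 7 * 12).
exists (2 * K)^-1, M; split; first by rewrite invr_gt0 mulr_gt0.
move=> x xd xL; have ht := hx x xd.
have x0 : x != 0 by have := xL 0; rewrite lam0.
have c3 : normc 3 = 3 :> R by rewrite -(rmorph_nat (real_complex R)) normc_real ger0_norm.
have h3 := is_sum_G w12 (isT : (3 <= 3)%N).
have h4 := is_sum_G w12 (isT : (3 <= 4)%N).
have h5 := is_sum_G w12 (isT : (3 <= 5)%N).
have h6 := is_sum_G w12 (isT : (3 <= 6)%N).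
rewrite (G_odd w12)// in h3; rewrite (G_odd w12)// in h5.
have nat_norm n : normc n%:R = n%:R :> R.
  by rewrite -(rmorph_nat (real_complex R)) normc_real ger0_norm.
have bnd (c : int * int -> R[i]) m : (forall l, normc (c l) <= 300) ->
    abs_bounded (fun l => x ^+ m * (lam l)^-1 ^+ 7 * c l) (M * normc x ^+ m).
  move=> hc; have -> : M * normc x ^+ m = normc x ^+ m * (300 * K ^+ 7) * 12 by rewrite /M; ring.
  apply: wt3_summand_bounded => [|l].
    by rewrite !mulr_ge0 ?exprn_ge0 ?normc_ge0 ?(ltW K0).
  rewrite !(normcM (_ * _)) (normcM (_ ^+ _)) (normcX x) -!(mulrA (normc x ^+ m)) ler_wpM2l ?exprn_ge0 ?normc_ge0//.
  have h7 := powX_bound (ltW K0) hK (isT : (3 <= 7)%N) l.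
  by rewrite mulrC -[leRHS]mulrA ler_pM ?normc_ge0.
split.
- pose c (l : int * int) := (6 - 5 * (x * (lam l)^-1)) * (1 - x * (lam l)^-1)^-1 ^+ 2.
  have hs : is_sum (fun l => x ^+ 5 * (lam l)^-1 ^+ 7 * c l)
      (wp x - (x ^- 2 + 3 * x ^+ 2 * G 4 + 5 * x ^+ 4 * G 6)).
    have := is_sumB (is_sum_wp w12 xL) (is_sumD (is_sumD (is_sumD (is_sumD
      (is_sum_delta 0 (x ^- 2)) (is_sumZ (2 * x) h3)) (is_sumZ (3 * x ^+ 2) h4))
      (is_sumZ (4 * x ^+ 3) h5)) (is_sumZ (5 * x ^+ 4) h6)).
    rewrite !mulr0 !addr0; apply: eq_is_sum => l.
    have [->|l0] := eqVneq l 0.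
      by rewrite /u /c lam0 invr0 !expr0n /= !subr0 !mulr0 exprVn !addr0 subrr mul0r.
    have lam_n0 : lam l != 0 by rewrite lam_eq0.
    have [t1 _] := inv1B_le2 (ht l).
    have t2 : lam l - x != 0.
      have -> : lam l - x = lam l * (1 - x / lam l) by field.
      by rewrite mulf_neq0.
    rewrite /u /c; field.
    by rewrite lam_n0 t2 -opprB oppr_eq0 t2.
  apply: is_sum_norm hs (bnd c 5 _) => l; have [_ t2] := inv1B_le2 (ht l).
  have tl := ht l; rewrite /c; move: (x / lam l) t2 tl => t t2 tl.
  rewrite normcM normcX; apply: (@le_trans _ _ (10 * 2 ^+ 2)); last by lra.
  rewrite ler_pM ?normc_ge0 ?exprn_ge0 ?normc_ge0//; last first.
    by rewrite lerXn2r ?nnegrE ?normc_ge0.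
  apply: le_trans (le_normcB _ _) _; rewrite normcM !nat_norm; lra.
- pose c (l : int * int) := - ((15 - 24 * (x * (lam l)^-1) + 10 * (x * (lam l)^-1) ^+ 2) * (1 - x * (lam l)^-1)^-1 ^+ 3).
  have hs : is_sum (fun l => x ^+ 4 * (lam l)^-1 ^+ 7 * c l)
      (S x 3 - (x ^- 3 - 3 * x * G 4 - 10 * x ^+ 3 * G 6)).
    have := is_sumB (is_sum_S w12 x (isT : (3 <= 3)%N)) (is_sumB (is_sumB (is_sumB (is_sumB
      (is_sum_delta 0 (x ^- 3)) (is_sumZ 1 h3)) (is_sumZ (3 * x) h4))
      (is_sumZ (6 * x ^+ 2) h5)) (is_sumZ (10 * x ^+ 3) h6)).
    rewrite !mulr0 !subr0; apply: eq_is_sum => l.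
    have [->|l0] := eqVneq l 0.
      by rewrite /u /c lam0 invr0 !expr0n /= !subr0 !mulr0 exprVn !subr0 subrr mul0r.
    have lam_n0 : lam l != 0 by rewrite lam_eq0.
    have [t1 _] := inv1B_le2 (ht l).
    have t2 : lam l - x != 0.
      have -> : lam l - x = lam l * (1 - x / lam l) by field.
      by rewrite mulf_neq0.
    rewrite /u /c; field.
    by rewrite lam_n0 t2 -opprB oppr_eq0 t2.
  apply: is_sum_norm hs (bnd c 4 _) => l; have [_ t2] := inv1B_le2 (ht l).
  have tl := ht l; rewrite /c normcN; move: (x / lam l) t2 tl => t t2 tl.
  rewrite normcM normcX; apply: (@le_trans _ _ (30 * 2 ^+ 3)); last by lra.
  rewrite ler_pM ?normc_ge0 ?exprn_ge0 ?normc_ge0//; last first.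
    by rewrite lerXn2r ?nnegrE ?normc_ge0.
  have tt : normc (t ^+ 2) <= (1 / 2) ^+ 2.
    by rewrite normcX lerXn2r ?nnegrE ?normc_ge0.
  apply: le_trans (le_normcD _ _) _.
  have h1 := le_normcB 15 (24 * t).
  rewrite normcM !nat_norm in h1; rewrite normcM nat_norm; lra.
Qed.
End Lattice.

(** * Reality on the real axis for a rectangular lattice *)

Section Rectangle.
Variables (R : realType) (a b : R).
Hypotheses (a0 : 0 < a) (b0 : 0 < b).
Let w1 : R[i] := (2 * a)%:C.
Let w2 : R[i] := 'i%C * (2 * b)%:C.
Local Notation lam := (lattice_pt w1 w2).
Local Notation u := (inv_diff w1 w2).
Local Notation S := (eis_sum w1 w2).
Local Notation wp := (wp_sum w1 w2).
Local Notation G := (eis_coef w1 w2).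
Local Notation regular := (regular w1 w2).

Lemma rect_w12 : complex.Im (w2 / w1) != 0.
Proof.
rewrite /w2 /w1 -mulrA -fmorphV -rmorphM /= !mul0r !mul1r add0r.
by rewrite mulf_neq0 ?invr_eq0 ?mulf_neq0 ?gt_eqF.
Qed.

Lemma lamE m n : lam (m, n) = ((2 * a) * m%:~R) +i* ((2 * b) * n%:~R).
Proof.
rewrite /lam /w1 /w2 /= -!(rmorph_int (real_complex R)) /=.
by apply/eqP; rewrite eq_complex /=; apply/andP; split; apply/eqP; ring.
Qed.

Lemma lam_conj m n : (lam (m, n))^*%C = lam (m, - n).
Proof. by rewrite !lamE /= intrN mulrN. Qed.

Lemma real_regular x : 0 < x < 2 * a -> regular x%:C.
Proof.
move=> /andP[x0 xa] [m n]; rewrite lamE; apply/eqP => -[xm _].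
have h1 : (0 : R) < m%:~R by move: x0; rewrite xm pmulr_rgt0 ?mulr_gt0.
have h2 : (m%:~R : R) < 1 by move: xa; rewrite xm gtr_pMr ?mulr_gt0.
move: h1 h2; rewrite ltr0z ltrz1; lia.
Qed.

(** Complex conjugation of the lattice points, read on indices. Reindexing by this involution shows
    that the sums at real points are real. *)
Definition conj_index (l : int * int) : int * int := (l.1, - l.2).
Local Notation cj := conj_index.

Lemma is_sum_cj (f : int * int -> R[i]) s : is_sum f s -> is_sum (f \o cj) s.
Proof. by apply: (is_sum_reindex (h' := cj)) => -[m n]; rewrite /cj /= opprK. Qed.

Lemma u_conj (x : R) l : (u x%:C l)^*%C = u x%:C (cj l).
Proof.
by case: l => m n; rewrite /u conjc_inv rmorphB /= lam_conj /cj /= oppr0.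
Qed.

Lemma conj_real (z : R[i]) : z^*%C = z -> z = (complex.Re z)%:C.
Proof.
case: z => x y [/eqP]; rewrite eq_sym -addr_eq0 -mulr2n mulrn_eq0 /= => /eqP ->.
by [].
Qed.

Definition wp_re (x : R) : R := complex.Re (wp x%:C).
Local Notation P := wp_re.
Definition eis_sum_re (x : R) k : R := complex.Re (S x%:C k).
Local Notation Sr := eis_sum_re.
Definition eis_coef_re k : R := complex.Re (G k).
Local Notation Gr := eis_coef_re.

Lemma SrE x k : (3 <= k)%N -> S x%:C k = (Sr x k)%:C.
Proof.
move=> k3; apply: conj_real; have h := is_sum_S rect_w12 x%:C k3.
apply: is_sum_unique (is_sum_conj h) _.
by apply: eq_is_sum (is_sum_cj h) => l /=; rewrite -u_conj rmorphXn.
Qed.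

Lemma GrE k : (3 <= k)%N -> G k = (Gr k)%:C.
Proof.
move=> k3; apply: conj_real; have h := is_sum_G rect_w12 k3.
apply: is_sum_unique (is_sum_conj h) _.
by apply: eq_is_sum (is_sum_cj h) => -[m n] /=; rewrite -lam_conj -conjc_inv rmorphXn.
Qed.

Lemma PE x : 0 < x < 2 * a -> wp x%:C = (P x)%:C.
Proof.
move=> hx; apply: conj_real; have h := is_sum_wp rect_w12 (real_regular hx).
apply: is_sum_unique (is_sum_conj h) _.
apply: eq_is_sum (is_sum_cj h) => -[m n] /=.
by rewrite rmorphB !rmorphXn /= u_conj conjc_inv lam_conj.
Qed.

Lemma P_sym x : 0 < x < 2 * a -> P (2 * a - x) = P x.
Proof.
move=> hx; rewrite /P rmorphB /=.
have -> : (2 * a)%:C = lam (1, 0) by rewrite lamE mulr1 mulr0.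
have hr := real_regular hx.
have hr' : regular (- x%:C).
  by move=> l; have := hr (- l); rewrite lamN eqr_oppLR.
by rewrite addrC (wp_shift rect_w12)// (wp_opp rect_w12).
Qed.

Lemma Sr_sym x k : (3 <= k)%N -> Sr (2 * a - x) k = (- 1) ^+ k * Sr x k.
Proof.
move=> k3; rewrite /Sr rmorphB /=.
have -> : (2 * a)%:C = lam (1, 0) by rewrite lamE mulr1 mulr0.
rewrite addrC (S_shift rect_w12)// (S_opp rect_w12)// SrE//.
by rewrite -(rmorphN1 (real_complex R)) -rmorphXn -rmorphM.
Qed.

Lemma key_real x : 0 < x < 2 * a ->
  5 * Sr x 6 = 2 * Sr x 3 ^+ 2 + 3 * (P x * Sr x 4).
Proof.
move=> hx; have := key rect_w12 (real_regular hx).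
rewrite !SrE// PE// => /(congr1 (@complex.Re R)).
rewrite -!(rmorph_nat (real_complex R)) -?rmorphXn -?rmorphM -?rmorphD -?rmorphM.
by [].
Qed.
End Rectangle.

(** * The real differential equation of a rectangular lattice *)

Lemma is_derive_taylor (R : realType) (f : R -> R) (x df d M : R) :
  0 < d -> (forall h, `|h| <= d -> `|f (x + h) - f x - h * df| <= M * h ^+ 2) ->
  is_derive x 1 f df.
Proof.
move=> d0 hf.
have hM : 0 <= M.
  have : 0 <= M * d ^+ 2.
    by apply: le_trans (normr_ge0 _) (hf d _); rewrite gtr0_norm.
  by rewrite pmulr_lge0// exprn_gt0.
have cv : (fun h : R => h^-1 *: (f (h *: 1 + x) - f x)) @ 0^' --> df.
  apply/cvgrPdist_le => e e0; near=> h.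
  have h0 : h != 0 by near: h; exact: nbhs_dnbhs_neq.
  have hd : `|h| <= d by near: h; apply: dnbhs0_le.
  have he : `|h| <= e / (M + 1) by near: h; apply: dnbhs0_le; rewrite divr_gt0// ltr_wpDl.
  rewrite [h *: 1]mulr1 [h + x]addrC distrC -[_ *: _]/(_ * _).
  have -> : h^-1 * (f (x + h) - f x) - df = h^-1 * (f (x + h) - f x - h * df) by field.
  rewrite normrM normfV ler_pdivrMl ?normr_gt0//.
  apply: le_trans (hf h hd) _; rewrite -real_normK ?num_real// expr2 mulrA mulrC.
  rewrite ler_wpM2l//; apply: (@le_trans _ _ ((M + 1) * `|h|)).
    by rewrite ler_wpM2r// lerDl.
  by rewrite mulrC -ler_pdivlMr// ltr_wpDl.
apply: DeriveDef; first by apply/cvg_ex; exists df.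
exact: cvg_lim cv.
Unshelve. all: by end_near. Qed.

Lemma is_derive_MVT (R : realType) (f df : R -> R) (c d x y : R) :
  (forall t, c < t < d -> is_derive t 1 f (df t)) -> c < x -> x < y -> y < d ->
  exists t, x < t < y /\ f y - f x = df t * (y - x).
Proof.
move=> hf cx xy yd.
have hd t : t \in `]x, y[ -> is_derive t 1 f (df t).
  by rewrite in_itv /= => /andP[h1 h2]; apply: hf; rewrite (lt_trans cx)// (lt_trans _ yd).
have hc : {within `[x, y], continuous f}.
  apply: derivable_within_continuous => t; rewrite in_itv /= => /andP[h1 h2].
  have h : is_derive t 1 f (df t) by apply: hf; rewrite (lt_le_trans cx)// (le_lt_trans _ yd).
  exact: ex_derive.
have [t] := MVT xy hd hc; rewrite in_itv /= => ht e.
by exists t.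
Qed.

Lemma is_derive0_cst (R : realType) (f : R -> R) (c d : R) :
  (forall t, c < t < d -> is_derive t 1 f 0) ->
  forall x y, c < x < d -> c < y < d -> f x = f y.
Proof.
move=> hf; suff h x y : c < x -> x < y -> y < d -> f x = f y.
  move=> x y /andP[x1 x2] /andP[y1 y2]; have [xy|xy|->//] := ltgtP x y; first exact: h.
  by apply/esym; exact: h.
move=> cx xy yd; have [t [_]] := is_derive_MVT (df := fun=> 0) hf cx xy yd.
by rewrite mul0r => /eqP; rewrite subr_eq0 => /eqP.
Qed.

Lemma le_small0 (R : realType) (r N d : R) : 0 < d ->
  (forall x, 0 < x <= d -> r <= N * x) -> r <= 0.
Proof.
move=> d0 h; rewrite leNgt; apply/negP => r0.
have N0 : 0 < `|N| + 1 by rewrite ltr_wpDl.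
pose x := Num.min d (r / (2 * (`|N| + 1))).
have hx : 0 < x by rewrite lt_min d0 divr_gt0// mulr_gt0.
have hxr : (`|N| + 1) * x <= r / 2.
  rewrite (_ : r / 2 = (`|N| + 1) * (r / (2 * (`|N| + 1)))); last by field; rewrite gt_eqF.
  by rewrite ler_pM2l// ge_min lexx orbT.
have := h x; rewrite hx ge_min lexx => /(_ isT) h1.
have : N * x <= (`|N| + 1) * x by rewrite ler_pM2r// ler_wpDr// ler_norm.
lra.
Qed.

Lemma laurent_coef0 (R : realType) (p q N d : R) : 0 < d ->
  (forall x, 0 < x <= d -> `|p * x ^- 2 + q| <= N * x) -> p = 0 /\ q = 0.
Proof.
move=> d0 h; have p0 : p = 0.
  apply/eqP; rewrite -normr_le0.
  have d1 : 0 < Num.min d 1 by rewrite lt_min d0 ltr01.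
  apply: (le_small0 d1 (N := `|q| + `|N|)) => x; rewrite le_min => /and3P[x0 xd x1].
  have := h x; rewrite x0 xd => /(_ isT) hx.
  have x20 : 0 < x ^+ 2 by rewrite exprn_gt0.
  have : `|(p * x ^- 2 + q) * x ^+ 2| <= N * x * x ^+ 2.
    by rewrite normrM (gtr0_norm x20) ler_pM2r.
  rewrite mulrDl divfK ?gt_eqF// => h1.
  have h2 : `|p| <= `|p + q * x ^+ 2| + `|q| * x ^+ 2.
    by have := ler_normB (p + q * x ^+ 2) (q * x ^+ 2); rewrite addrK normrM (gtr0_norm x20).
  have h3 : x ^+ 2 <= x by rewrite expr2 ger_pMr.
  have h4 : `|q| * x ^+ 2 <= `|q| * x by rewrite ler_wpM2l.
  have h5 : N * x * x ^+ 2 <= `|N| * x.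
    apply: (@le_trans _ _ (`|N| * x * x ^+ 2)).
      by rewrite -!mulrA ler_wpM2r ?ler_norm// mulr_ge0// ltW.
    by rewrite ler_piMr// ?mulr_ge0// ?(ltW x0)// (le_trans h3).
  lra.
split=> //; apply/eqP; rewrite -normr_le0; apply: (le_small0 d0 (N := N)) => x hx.
by have := h x hx; rewrite p0 mul0r add0r.
Qed.

Section Rectangle.
Variables (R : realType) (a b : R).
Hypotheses (a0 : 0 < a) (b0 : 0 < b).
Let w1 : R[i] := (2 * a)%:C.
Let w2 : R[i] := 'i%C * (2 * b)%:C.
Local Notation P := (wp_re a b).
Local Notation Sr := (eis_sum_re a b).
Local Notation Gr := (eis_coef_re a b).
Let w12 := rect_w12 a0 b0.

Lemma Sr_derive x k : (3 <= k)%N -> 0 < x < 2 * a ->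
  is_derive x 1 (fun x => Sr x k) (- k%:R * Sr x k.+1).
Proof.
move=> k3 hx; have hr := real_regular a0 b0 hx.
have [d [M [d0 hM]]] := S_taylor w12 hr k3.
apply: (@is_derive_taylor _ _ _ _ d M) => // h hd.
have := hM h%:C; rewrite normc_real => /(_ hd).
rewrite -rmorphD /= !SrE// ?(leqW k3)// -(rmorph_nat (real_complex R)).
rewrite -!rmorphM -rmorphB -rmorphD !normc_real real_normK ?num_real//.
by congr (`|_| <= _); ring.
Qed.

Lemma P_derive x : 0 < x < 2 * a -> is_derive x 1 P (- 2 * Sr x 3).
Proof.
move=> hx; have hr := real_regular a0 b0 hx.
have [d [M [d0 hM]]] := wp_taylor w12 hr.
pose e := Num.min d (Num.min (x / 2) ((2 * a - x) / 2)).
have /andP[x0 xa] := hx.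
have e0 : 0 < e by rewrite !lt_min d0 !divr_gt0// subr_gt0.
apply: (@is_derive_taylor _ _ _ _ e M) => // h.
rewrite !le_min => /andP[hd /andP[hx1 hx2]].
have hxh : 0 < x + h < 2 * a.
  by move: hx1 hx2; rewrite !ler_norml => /andP[? ?] /andP[? ?]; apply/andP; split; lra.
have := hM h%:C; rewrite normc_real => /(_ hd).
rewrite -rmorphD /= => /(_ (real_regular a0 b0 hxh)).
rewrite !PE// SrE// -(rmorph_nat (real_complex R)).
rewrite -!rmorphM -rmorphB -rmorphD !normc_real real_normK ?num_real//.
by congr (`|_| <= _); ring.
Qed.

Lemma mid_in : 0 < a < 2 * a.
Proof. by rewrite a0 ltr_pMl ?ltr1n. Qed.

Lemma Sr_mid k : (3 <= k)%N -> odd k -> Sr a k = 0.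
Proof.
move=> k3 ko; have := Sr_sym a0 b0 a k3.
rewrite (_ : 2 * a - a = a); last by ring.
by rewrite -signr_odd ko expr1 => ?; lra.
Qed.

(** [K1] is a quarter of the derivative of S_4 - P^2, and [key_real] says that its own derivative is
    0. It vanishes at the midpoint a, where the sums of odd order do. *)
Lemma S4_wp2 : exists c, forall x, 0 < x < 2 * a -> Sr x 4 = P x ^+ 2 + c.
Proof.
pose K1 x := P x * Sr x 3 - Sr x 5.
have K10 x : 0 < x < 2 * a -> K1 x = 0.
  move=> hx; have <- : K1 a = 0 by rewrite /K1 !Sr_mid// mulr0 subr0.
  apply: is_derive0_cst hx mid_in => t ht.
  have hP := P_derive ht; have h3 := @Sr_derive t 3 isT ht; have h5 := @Sr_derive t 5 isT ht.
  rewrite /K1; apply: is_derive_eq.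
  have := key_real a0 b0 ht.
  rewrite /GRing.scale /=.  lra.
exists (Sr a 4 - P a ^+ 2) => x hx; apply/eqP; rewrite -subr_eq0 opprD addrA subr_eq0; apply/eqP.
apply: (is_derive0_cst (f := fun t => Sr t 4 - P t ^+ 2)) hx mid_in => t ht.
have hP := P_derive ht; have h4 := @Sr_derive t 4 isT ht.
apply: is_derive_eq.
have := K10 t ht; rewrite /K1 /GRing.scale /= => ?.  nra.
Qed.

Lemma S3_cubic : exists c d, forall x, 0 < x < 2 * a ->
  Sr x 4 = P x ^+ 2 + c /\ Sr x 3 ^+ 2 = P x ^+ 3 + 3 * c * P x + d.
Proof.
have [c hc] := S4_wp2; exists c, (Sr a 3 ^+ 2 - P a ^+ 3 - 3 * c * P a) => x hx.
split; first exact: hc.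
suff : Sr x 3 ^+ 2 - P x ^+ 3 - 3 * c * P x = Sr a 3 ^+ 2 - P a ^+ 3 - 3 * c * P a.
  by move=> <-; ring.
apply: (is_derive0_cst (f := fun t => Sr t 3 ^+ 2 - P t ^+ 3 - 3 * c * P t)) hx mid_in => t ht.
have hP := P_derive ht; have h3 := @Sr_derive t 3 isT ht.
apply: is_derive_eq.
rewrite /GRing.scale /= (hc t ht); ring.
Qed.

Lemma P_expansion : exists d M : R, [/\ 0 < d, d < 2 * a, d <= 1, 0 <= M & forall x, 0 < x <= d ->
  `|P x - (x ^- 2 + 3 * x ^+ 2 * Gr 4 + 5 * x ^+ 4 * Gr 6)| <= M * x ^+ 5 /\
  `|Sr x 3 - (x ^- 3 - 3 * x * Gr 4 - 10 * x ^+ 3 * Gr 6)| <= M * x ^+ 4].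
Proof.
have [d [M [d0 hM]]] := wp_expansion w12.
exists (Num.min d (Num.min a 1)), `|M|.
have hmin : 0 < Num.min d (Num.min a 1) by rewrite !lt_min d0 a0 ltr01.
split=> //; first by rewrite !gt_min ltr_pMl// ltr1n orbT.
  by rewrite !ge_min lexx !orbT.
move=> x; rewrite !le_min => /and4P[x0 xd xa x1].
have hx : 0 < x < 2 * a by rewrite x0 (le_lt_trans xa)// ltr_pMl// ltr1n.
have := hM x%:C; rewrite normc_real gtr0_norm// => /(_ xd (real_regular a0 b0 hx)).
rewrite PE// SrE// !(GrE a0 b0)// -!(rmorph_nat (real_complex R)).
rewrite -?rmorphXn -?fmorphV -?rmorphM -?rmorphD -?rmorphB !normc_real => -[h1 h2].
have le_M n : M * x ^+ n <= `|M| * x ^+ n.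
  by rewrite ler_wpM2r ?ler_norm// exprn_ge0// ltW.
by split; [apply: le_trans (le_M 5) | apply: le_trans (le_M 4)].
Qed.

(** Put al = 3 G_4 and be = 5 G_6. In S_3^2 = P^3 + 3 c P + e the coefficients of x^-2 are -2 al and
    3 al + 3 c, and the constant terms are -4 be and 3 be + e. Hence c = -5 G_4 and e = -35 G_6. *)
Lemma S3_wp_cubic x : 0 < x < 2 * a ->
  Sr x 4 = P x ^+ 2 - 5 * Gr 4 /\
  Sr x 3 ^+ 2 = P x ^+ 3 - 15 * Gr 4 * P x - 35 * Gr 6.
Proof.
have [c [e hce]] := S3_cubic.
have [d [M [d0 d2a d1 M0 hM]]] := P_expansion.
pose al := 3 * Gr 4; pose be := 5 * Gr 6.
pose t := `|al| + 2 * `|be| + M.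
have t0 : 0 <= t by rewrite !addr_ge0 ?mulr_ge0.
have [h1 h2] : 5 * al + 3 * c = 0 /\ 7 * be + e = 0.
  apply: (@laurent_coef0 _ _ _ (5 * M + (t ^+ 2 + 3 * t ^+ 2 + t ^+ 3 + 3 * `|c| * t)) d) => // y hy.
  have /andP[y0 yd] := hy; have y1 := le_trans yd d1.
  have yn0 : y != 0 by rewrite gt_eqF.
  have hy' : 0 < y < 2 * a by rewrite y0 (le_lt_trans yd).
  have [_ hcub] := hce y hy'; have [hP hS] := hM y hy.
  pose rho := (P y - (y ^- 2 + 3 * y ^+ 2 * Gr 4 + 5 * y ^+ 4 * Gr 6)) / y ^+ 5.
  pose sig := (Sr y 3 - (y ^- 3 - 3 * y * Gr 4 - 10 * y ^+ 3 * Gr 6)) / y ^+ 4.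
  have rM : `|rho| <= M.
    by rewrite normrM normfV ler_pdivrMr ?normr_gt0 ?expf_neq0// (gtr0_norm (exprn_gt0 _ y0)).
  have sM : `|sig| <= M.
    by rewrite normrM normfV ler_pdivrMr ?normr_gt0 ?expf_neq0// (gtr0_norm (exprn_gt0 _ y0)).
  (* X and Y are the regular parts in P = y^-2 + y^2 X and S_3 = y^-3 + y Y. Both are bounded by t,
     which turns the comparison of coefficients into an explicit O(y) estimate. *)
  pose X := al + be * y ^+ 2 + y ^+ 3 * rho.
  pose Y := - al - 2 * be * y ^+ 2 + y ^+ 3 * sig.
  have PX : P y = y ^- 2 + y ^+ 2 * X by rewrite /X /rho /al /be; field.
  have SY : Sr y 3 = y ^- 3 + y * Y by rewrite /Y /sig /al /be; field.
  clearbody rho sig.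
  have pow1 n : 0 <= y ^+ n <= 1 by rewrite exprn_ge0 ?exprn_ile1 ?(ltW y0).
  have small (v : R) n : `|v * y ^+ n| <= `|v|.
    have /andP[p0 p1] := pow1 n; by rewrite normrM (ger0_norm p0) ler_piMr.
  have Xt : `|X| <= t.
    apply: le_trans (ler_normD _ _) _; apply: lerD; last first.
      by rewrite mulrC; apply: le_trans (small _ _) rM.
    apply: le_trans (ler_normD _ _) _; apply: lerD => //.
    by apply: le_trans (small _ _) _; rewrite ler_peMl// ler1n.
  have Yt : `|Y| <= t.
    apply: le_trans (ler_normD _ _) _; apply: lerD; last first.
      by rewrite mulrC; apply: le_trans (small _ _) sM.
    apply: le_trans (ler_normB _ _) _; apply: lerD; first by rewrite normrN.
    by apply: le_trans (small _ _) _; rewrite normrM ger0_norm.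
  have -> : (5 * al + 3 * c) * y ^- 2 + (7 * be + e) =
     y * ((2 * sig - 3 * rho) + y * (Y ^+ 2 - 3 * X ^+ 2 - y ^+ 4 * X ^+ 3 - 3 * c * X)).
    have <- : (5 * al + 3 * c) * y ^- 2 + (7 * be + e)
       + (Sr y 3 ^+ 2 - (P y ^+ 3 + 3 * c * P y + e)) =
       y * ((2 * sig - 3 * rho) + y * (Y ^+ 2 - 3 * X ^+ 2 - y ^+ 4 * X ^+ 3 - 3 * c * X)).
      by rewrite PX SY /X /Y; field.
    by rewrite hcub subrr addr0.
  rewrite normrM (gtr0_norm y0) mulrC ler_pM2r//.
  apply: le_trans (ler_normD _ _) _; apply: lerD.
    apply: le_trans (ler_normB _ _) _; rewrite !normrM !normr_nat; lra.
  rewrite mulrC -[y]expr1; apply: le_trans (small _ _) _.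
  apply: le_trans (ler_normB _ _) _; apply: lerD; last first.
    by rewrite !normrM normr_nat ler_wpM2l// mulr_ge0.
  apply: le_trans (ler_normB _ _) _; apply: lerD; last first.
    rewrite mulrC expr1; apply: le_trans (small _ _) _.
    by rewrite normrX lerXn2r// nnegrE.
  apply: le_trans (ler_normB _ _) _; apply: lerD.
    by rewrite normrX lerXn2r// nnegrE.
  by rewrite normrM normr_nat normrX ler_wpM2l// lerXn2r// nnegrE.
move=> hx; have [-> ->] := hce x hx.
have -> : c = - 5 * Gr 4 by rewrite /al in h1; lra.
have -> : e = - 35 * Gr 6 by rewrite /be in h2; lra.
by split; ring.
Qed.

Lemma P_pole : exists d M : R, [/\ 0 < d, d < 2 * a & forall x, 0 < x <= d -> `|P x - x ^- 2| <= M].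
Proof.
have [d [M [d0 d2a d1 M0 hM]]] := P_expansion.
exists d, (M + `|3 * Gr 4| + `|5 * Gr 6|); split=> // x hx.
have /andP[x0 xd] := hx; have x1 := le_trans xd d1.
have pow1 n : 0 <= x ^+ n <= 1 by rewrite exprn_ge0 ?exprn_ile1 ?(ltW x0).
have small (v : R) n : `|v * x ^+ n| <= `|v|.
  have /andP[p0 p1] := pow1 n; by rewrite normrM (ger0_norm p0) ler_piMr.
have [hP _] := hM x hx.
have -> : P x - x ^- 2 = (P x - (x ^- 2 + 3 * x ^+ 2 * Gr 4 + 5 * x ^+ 4 * Gr 6))
   + 3 * Gr 4 * x ^+ 2 + 5 * Gr 6 * x ^+ 4 by ring.
apply: le_trans (ler_normD _ _) _; apply: lerD; last exact: small.
apply: le_trans (ler_normD _ _) _; apply: lerD; last exact: small.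
apply: le_trans hP _; have /andP[p0 p1] := pow1 5%N; by rewrite ler_piMr.
Qed.
End Rectangle.

(** * The time integral and its hypergeometric expansion *)

Lemma is_derive_bigsum (R : realType) (f : nat -> R -> R) (df : nat -> R) (x : R) N :
  (forall n, is_derive x 1 (f n) (df n)) ->
  is_derive x 1 (fun t => \sum_(n < N) f n t) (\sum_(n < N) df n).
Proof.
move=> hf; rewrite (_ : (fun t => _) = \sum_(n < N) f n); last first.
  by apply/funext => t; rewrite fct_sumE.
by apply: is_derive_sum => i; exact: hf.
Qed.

Lemma is_derive_powf (R : realType) (f : R -> R) (df x : R) n :
  is_derive x 1 f df -> is_derive x 1 (fun t => f t ^+ n) (n%:R * f x ^+ n.-1 * df).
Proof. by move=> /(is_deriveX n); rewrite exprfctE. Qed.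

(** The reduction formula for the integral of sin^n. *)
Fixpoint sin_pow_primitive (R : realType) (n : nat) (t : R) : R :=
  match n with
  | 0%N => t
  | 1%N => - cos t
  | (m.+1 as k).+1 => k.+1%:R^-1 * (k%:R * sin_pow_primitive m t - sin t ^+ k * cos t)
  end.

Lemma sin_pow_primitiveSS (R : realType) n (t : R) :
  sin_pow_primitive n.+2 t =
    n.+2%:R^-1 * (n.+1%:R * sin_pow_primitive n t - sin t ^+ n.+1 * cos t).
Proof. by []. Qed.

Lemma sin_pow_primitive_derive (R : realType) n (t : R) :
  is_derive t 1 (@sin_pow_primitive R n) (sin t ^+ n).
Proof.
suff : is_derive t 1 (@sin_pow_primitive R n) (sin t ^+ n) /\
       is_derive t 1 (@sin_pow_primitive R n.+1) (sin t ^+ n.+1) by case.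
elim: n => [|n [h1 h2]].
  split; first by rewrite expr0 /=; exact: is_derive_id.
  by rewrite expr1 /=; apply: is_derive_eq; rewrite opprK.
split; first exact: h2.
rewrite (_ : @sin_pow_primitive R n.+2 = (fun s =>
  n.+2%:R^-1 * (n.+1%:R * sin_pow_primitive n s - sin s ^+ n.+1 * cos s))); last exact/funext.
move: (@sin_pow_primitive R n) h1 => W h1.
have hs := is_derive_sin t; have hc := is_derive_cos t.
have hX : is_derive t 1 (fun s : R => sin s ^+ n.+1) (n.+1%:R * sin t ^+ n * cos t).
  exact: is_derive_powf.
have hXc : is_derive t 1 (fun s : R => sin s ^+ n.+1 * cos s)
    (sin t ^+ n.+1 * (- sin t) + cos t * (n.+1%:R * sin t ^+ n * cos t)).
  by apply: is_derive_eq.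
have hW : is_derive t 1 (fun s : R => n.+1%:R * W s) (n.+1%:R * sin t ^+ n).
  by apply: is_derive_eq.
have hB : is_derive t 1 (fun s : R => n.+1%:R * W s - sin s ^+ n.+1 * cos s)
   (n.+2%:R * sin t ^+ n.+2).
  apply: is_derive_eq.
  have : cos t * cos t = 1 - sin t ^+ 2 by rewrite -expr2 cos2sin2.
  rewrite -!natr1 !exprS; move: (cos t) (sin t) => c s; move: (s ^+ n) => sn hcs.
  rewrite (_ : c * (_ * c) = (n%:R + 1) * sn * (c * c)); last by ring.
  by rewrite hcs; ring.
apply: is_derive_eq; rewrite /GRing.scale /=.
by rewrite mulrA mulVf ?mul1r// pnatr_eq0.
Qed.

(* The coefficients of (1 - s)^(-1/2). *)
Definition bcoef (R : realType) (n : nat) : R :=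
  \prod_(i < n) ((i%:R + 2^-1) / i.+1%:R).

Lemma bcoef_ge0 (R : realType) n : 0 <= bcoef R n.
Proof. by apply: prodr_ge0 => i _; rewrite divr_ge0// addr_ge0. Qed.

Lemma bcoef_gt0 (R : realType) n : 0 < bcoef R n.
Proof. by apply: prodr_gt0 => i _; apply: divr_gt0 => //; apply: ltr_wpDl. Qed.

Lemma bcoef_le1 (R : realType) n : bcoef R n <= 1.
Proof.
apply: prodr_ile1 => i _; rewrite divr_ge0 ?addr_ge0//= ler_pdivrMr// mul1r.
by rewrite -(natr1 i) lerD2l invf_le1// ler1n.
Qed.

Lemma bcoefS (R : realType) n : n.+1%:R * bcoef R n.+1 = (n%:R + 2^-1) * bcoef R n.
Proof.
rewrite /bcoef big_ord_recr /=; move: (\prod_(i < n) _) => p.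
by field; rewrite nat1r pnatr_eq0.
Qed.

Lemma sin_pow_primitive_pihalf (R : realType) n :
  sin_pow_primitive n (pi / 2 : R) - sin_pow_primitive n (- (pi / 2)) =
  if odd n then 0 else pi * bcoef R n./2.
Proof.
suff : (forall m, (m = n \/ m = n.+1) ->
  sin_pow_primitive m (pi / 2 : R) - sin_pow_primitive m (- (pi / 2)) =
  if odd m then 0 else pi * bcoef R m./2) by apply; left.
elim: n => [|n IH] m [->|->].
- by rewrite /= /bcoef big_ord0; field.
- by rewrite /= cosN cos_pihalf; ring.
- by rewrite IH//; right.
- rewrite !sin_pow_primitiveSS cosN cos_pihalf !mulr0 !subr0 -!mulrBr IH; last by left.
  rewrite /= negbK; case: ifP => on; first by rewrite !mulr0.
  have := bcoefS R n./2.
  have hn : (n%:R : R) = 2 * (n./2)%:R.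
    by rewrite -natrM mul2n -[in LHS](odd_double_half n) on.
  rewrite -(natr1 n./2) -(natr1 n.+1) -(natr1 n) hn; move: (bcoef R _) (bcoef R _) => x y h.
  have h0 : (0 : R) <= (n./2)%:R by [].
  have := h; move: (n./2)%:R h0 => c c0 {}h.
  have -> : y = (c + 2^-1) * x / (c + 1) by rewrite -h mulrC mulrA mulVf ?mul1r//; lra.
  by field; apply/andP; split; lra.
Qed.

Definition bsum (R : realType) (N : nat) (s : R) : R := \sum_(n < N) bcoef R n * s ^+ n.

(** The full series f satisfies (1 - s) f' = f / 2; truncation leaves a single monomial as
    defect. *)
Lemma bsum_ode (R : realType) N (s : R) :
  (1 - s) * (\sum_(n < N.+1) bcoef R n * (n%:R * s ^+ n.-1)) - 2^-1 * bsum N.+1 s =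
  - (N.+1%:R * bcoef R N.+1 * s ^+ N).
Proof.
elim: N => [|N IH].
  by rewrite /bsum !big_ord_recr !big_ord0 /= bcoefS /bcoef !big_ord0; ring.
have -> : bsum N.+2 s = bsum N.+1 s + bcoef R N.+1 * s ^+ N.+1.
  by rewrite /bsum big_ord_recr.
rewrite big_ord_recr /= bcoefS exprS -(natr1 N).
rewrite -(natr1 N) in IH.
set A := \sum_(n < N.+1) _ in IH *; set B := bsum N.+1 s in IH *.
by clearbody A B; lra.
Qed.

Lemma bsum_derive (R : realType) N (s : R) :
  is_derive s 1 (@bsum R N) (\sum_(n < N) bcoef R n * (n%:R * s ^+ n.-1)).
Proof.
apply: (@is_derive_bigsum R (fun n s => bcoef R n * s ^+ n)
  (fun n => bcoef R n * (n%:R * s ^+ n.-1))) => n.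
have h := is_derive_powf n (is_derive_id s (1 : R)).
by apply: is_derive_eq; rewrite mulr1.
Qed.

(** With 1 / k = 1 + h, the quadratic term of the binomial expansion of (1 + h)^N outgrows the
    factor N. *)
Lemma nat_mul_expr_small (R : realType) (k e : R) : 0 < k < 1 -> 0 < e ->
  exists N0 : nat, forall N, (N0 <= N)%N -> N%:R * k ^+ N <= e.
Proof.
move=> /andP[k0 k1] e0; pose h := k^-1 - 1.
have h0 : 0 < h by rewrite subr_gt0 invf_gt1.
have bin N : 1 + N%:R * h + N%:R * (N%:R - 1) / 2 * h ^+ 2 <= (1 + h) ^+ N.
  elim: N => [|N IH]; first by rewrite !mul0r !addr0 expr0.
  rewrite (exprS (1 + h)); have h1 : 0 <= 1 + h by rewrite addr_ge0// ltW.
  apply: le_trans _ (ler_wpM2l h1 IH); rewrite -subr_ge0 -(natr1 N).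
  rewrite (_ : _ - _ = N%:R * (N%:R - 1) / 2 * h ^+ 3); last by field.
  rewrite mulr_ge0 ?exprn_ge0 ?(ltW h0)// divr_ge0//.
  by case: N {IH} => [|N]; rewrite ?mul0r// mulr_ge0// subr_ge0 ler1n.
have hk : 1 + h = k^-1 by rewrite /h addrC subrK.
pose X := 2 / (e * h ^+ 2).
exists (Num.truncn X).+2 => N hN.
have N1 : X < N%:R - 1.
  have : X + 1 < N%:R.
    apply: (@lt_le_trans _ _ (Num.truncn X).+2%:R); last by rewrite ler_nat.
    by rewrite -(natr1 (Num.truncn X).+1) ltrD2r truncnS_gt.
  by lra.
have X0 : 0 < X by rewrite divr_gt0// mulr_gt0// exprn_gt0.
have kN : 0 < k ^+ N by rewrite exprn_gt0.
have h2 : N%:R * (N%:R - 1) / 2 * h ^+ 2 <= (k ^+ N)^-1.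
  rewrite -exprVn -hk; apply: le_trans _ (bin N).
  by rewrite lerDr addr_ge0// mulr_ge0// ltW.
have h3 : N%:R * (N%:R - 1) / 2 * h ^+ 2 * k ^+ N <= 1 by rewrite -ler_pdivlMr// div1r.
have N0 : (0 : R) <= N%:R by [].
have Nk0 : 0 <= N%:R * k ^+ N by rewrite mulr_ge0// ltW.
have h20 : 0 < h ^+ 2 by rewrite exprn_gt0.
have h4 : X * (N%:R * k ^+ N) * (h ^+ 2 / 2) <= 1.
  apply: le_trans _ h3.
  rewrite (_ : N%:R * (N%:R - 1) / 2 * h ^+ 2 * k ^+ N = (N%:R - 1) * (N%:R * k ^+ N) * (h ^+ 2 / 2)); last by ring.
  by rewrite ler_wpM2r ?divr_ge0 ?(ltW h20)// ler_wpM2r// ltW.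
have := h4; rewrite (_ : X * _ * _ = N%:R * k ^+ N / e); last first.
  by rewrite /X; field; rewrite !gt_eqF.
by rewrite ler_pdivrMr// mul1r.
Qed.

(** By [bsum_ode] the product has the derivative -(N+1) b_(N+1) s^N / sqrt (1 - s), and it equals 1
    at 0. The mean value theorem then gives the error without any infinite series. *)
Lemma bsum_bound (R : realType) N (k s : R) : 0 < k < 1 -> `|s| <= k ->
  `|Num.sqrt (1 - s) * bsum N.+1 s - 1| <= N.+1%:R * k ^+ N.+1 / Num.sqrt (1 - k).
Proof.
move=> /andP[k0 k1] sk.
pose D (t : R) := Num.sqrt (1 - t) * bsum N.+1 t.
pose dD (t : R) := - (Num.sqrt (1 - t))^-1 * (N.+1%:R * bcoef R N.+1 * t ^+ N).
have hD (t : R) : -1 < t < 1 -> is_derive t 1 D (dD t).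
  move=> /andP[t1 t2]; have hb := bsum_derive N.+1 t.
  have st : 0 < 1 - t by rewrite subr_gt0.
  have hs : is_derive t 1 (fun t : R => Num.sqrt (1 - t)) (- (2 * Num.sqrt (1 - t))^-1).
    have h1 : is_derive t 1 (fun t : R => 1 - t) (- 1).
      by apply: is_derive_eq; rewrite ?add0r mul1r.
    have h2 := @is_derive1_comp R Num.sqrt (fun t : R => 1 - t) t _ _ (is_derive1_sqrt st) h1.
    by apply: is_derive_eq h2 _; rewrite mulrN1.
  rewrite /D; apply: is_derive_eq; rewrite /GRing.scale /= /dD.
  have q0 : Num.sqrt (1 - t) != 0 by rewrite gt_eqF// sqrtr_gt0.
  have q2 : Num.sqrt (1 - t) ^+ 2 = 1 - t by rewrite sqr_sqrtr// ltW.
  rewrite mulNr -[X in _ = X]mulrN -bsum_ode; move: (Num.sqrt _) q0 q2 => q q0 <-.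
  by field.
have D0 : D 0 = 1.
  rewrite /D subr0 sqrtr1 mul1r /bsum big_ord_recl /= expr0 /bcoef big_ord0 big1 ?mulr1 ?addr0//.
  by move=> i _; rewrite /= exprS mul0r mulr0.
have mvt (x y : R) : -1 < x -> x < y -> y < 1 -> exists t, x < t < y /\ D y - D x = dD t * (y - x).
  exact: is_derive_MVT hD.
have bd (t : R) : `|t| <= `|s| -> `|dD t| <= N.+1%:R * k ^+ N / Num.sqrt (1 - k).
  move=> ts; have tk := le_trans ts sk.
  have tk' : t <= k := le_trans (ler_norm t) tk.
  have kk : 0 < 1 - k by rewrite subr_gt0.
  rewrite /dD mulNr normrN mulrC normrM; apply: ler_pM => //.
    rewrite normrM ger0_norm ?mulr_ge0 ?bcoef_ge0// normrX.
    apply: ler_pM; rewrite ?mulr_ge0 ?bcoef_ge0 ?exprn_ge0//.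
      by rewrite ler_piMr// bcoef_le1.
    by rewrite lerXn2r// nnegrE// (ltW k0).
  have h : Num.sqrt (1 - k) <= Num.sqrt (1 - t) by rewrite ler_wsqrtr// lerD2l lerN2.
  have h0 : 0 < Num.sqrt (1 - k) by rewrite sqrtr_gt0.
  rewrite ger0_norm ?invr_ge0 ?sqrtr_ge0// lef_pV2// posrE//.
  exact: lt_le_trans h0 h.
have fin (t : R) : `|t| <= `|s| -> `|D s - 1| = `|dD t * s| ->
    `|D s - 1| <= N.+1%:R * k ^+ N.+1 / Num.sqrt (1 - k).
  move=> ts ->; rewrite normrM.
  rewrite (_ : _ / _ = N.+1%:R * k ^+ N / Num.sqrt (1 - k) * k); last by rewrite exprSr; ring.
  by apply: ler_pM => //; exact: bd.
have [s0|s0|s0] := ltgtP s 0.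
- have s1 : -1 < s.
    by move: sk; rewrite ltr0_norm// => ?; lra.
  have [t [/andP[t1 t2]]] := mvt s 0 s1 s0 ltr01; rewrite D0 sub0r => h.
  apply: (fin t); first by rewrite !ltr0_norm// lerN2 ltW.
  by rewrite -normrN opprB h mulrN normrN.
- have s1 : s < 1 by apply: le_lt_trans (ler_norm s) (le_lt_trans sk k1).
  have [t [/andP[t1 t2]]] := mvt 0 s (ltrN10 R) s0 s1; rewrite D0 subr0 => h.
  by apply: (fin t); [rewrite !gtr0_norm// ltW|rewrite h].
- rewrite -/(D s) s0 D0 subrr normr0 divr_ge0 ?mulr_ge0 ?exprn_ge0 ?sqrtr_ge0//.
  exact: ltW.
Qed.

(** Write (c)_n for the rising factorial. Then b_n = (1/2)_n / n!, (1/2)_(2n) = 4^n (1/4)_n (3/4)_n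
    and (2n)! = 4^n n! (1/2)_n, so the factors (1/2)_n cancel in the product on the right. *)
Lemma hypergeo_coef (R : realType) n :
  pochhammer (1 / 4 : R) n * pochhammer (3 / 4) n / (pochhammer 1 n * n`!%:R) =
  bcoef R n.*2 * bcoef R n.
Proof.
elim: n => [|n IH]; first by rewrite /pochhammer /bcoef double0 !big_ord0 fact0 !mulr1 divr1.
have hb m : bcoef R m.+1 = (m%:R + 2^-1) / m.+1%:R * bcoef R m.
  by rewrite mulrAC -bcoefS mulrC mulKf// pnatr_eq0.
rewrite doubleS !hb.
have -> : bcoef R n.*2 = pochhammer (1 / 4 : R) n * pochhammer (3 / 4) n / (pochhammer 1 n * n`!%:R) / bcoef R n.
  by rewrite IH mulfK// gt_eqF// bcoef_gt0.
have hp (c : R) : pochhammer c n.+1 = pochhammer c n * (c + n%:R) by rewrite /pochhammer big_ord_recr.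
have b0 : bcoef R n != 0 by rewrite gt_eqF// bcoef_gt0.
have f0 : n`!%:R != 0 :> R by rewrite pnatr_eq0 -lt0n fact_gt0.
have p0 : pochhammer (1 : R) n != 0.
  by rewrite gt_eqF//; apply: prodr_gt0 => i _; apply: ltr_pwDl.
rewrite !hp factS natrM -muln2 -(natr1 n) -(natr1 (n * 2).+1) -(natr1 (n * 2)) natrM.
have : (0 : R) <= n%:R by [].
move: (n%:R : R) (pochhammer _ n) (pochhammer (3 / 4) n) (pochhammer 1 n) (n`!%:R) (bcoef R n) f0 p0 b0.
move=> c p1 p2 p3 f b f0 p0 b0 c0; field.
by rewrite f0 p0 b0 /=; repeat (apply/andP; split); apply: lt0r_neq0; lra.
Qed.

Definition sin_sum (R : realType) (k : R) N (t : R) : R :=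
  \sum_(n < N) bcoef R n * k ^+ n * sin_pow_primitive n t.

Lemma sin_sum_derive (R : realType) (k : R) N (t : R) :
  is_derive t 1 (sin_sum k N) (bsum N (k * sin t)).
Proof.
rewrite /bsum (eq_bigr (fun n : 'I_N => bcoef R n * k ^+ n * sin t ^+ n)); last first.
  by move=> i _; rewrite exprMn mulrA.
apply: (@is_derive_bigsum R (fun n t => bcoef R n * k ^+ n * sin_pow_primitive n t)
  (fun n => bcoef R n * k ^+ n * sin t ^+ n)) => n.
by have h := sin_pow_primitive_derive n t; apply: is_derive_eq.
Qed.

(** Over [-pi/2, pi/2] the odd powers of sin integrate to 0 and sin^(2n) to pi b_n, which leaves the
    coefficients b_(2n) b_n of [hypergeo_coef]. *)
Lemma sin_sum_pihalf (R : realType) (k : R) M :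
  sin_sum k M.*2 (pi / 2) - sin_sum k M.*2 (- (pi / 2)) =
  pi * series (fun n => pochhammer (1 / 4 : R) n * pochhammer (3 / 4) n
               / (pochhammer 1 n * n`!%:R) * (k ^+ 2) ^+ n) M.
Proof.
rewrite /series /= big_mkord /sin_sum -sumrB.
under eq_bigr do rewrite -mulrBr sin_pow_primitive_pihalf.
elim: M => [|M IH]; first by rewrite !big_ord0 mulr0.
rewrite doubleS !big_ord_recr /= IH odd_double doubleK hypergeo_coef mulr0 addr0 -exprM mul2n.
by ring.
Qed.

(* Set y = sin th.  Along the solution the truncated primitive
   sin_sum k N (th x) has derivative sqrt C * (1 + O(N k^N)). *)
Lemma hypergeo_time (R : realType) (a C k : R) (y dy : R -> R) :
  0 < a -> 0 < C -> 0 < k < 1 ->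
  (forall x, 0 < x < a -> is_derive x 1 y (dy x)) ->
  (forall x, 0 < x < a -> 0 < dy x) ->
  (forall x, 0 < x < a -> -1 < y x < 1) ->
  (forall x, 0 < x < a -> dy x ^+ 2 = C * (1 - k * y x) * (1 - y x ^+ 2)) ->
  (forall e, 0 < e -> exists x, [/\ 0 < x, x < a, x < e & y x < -1 + e]) ->
  (forall e, 0 < e -> exists x, [/\ 0 < x, x < a, a - e < x & 1 - e < y x]) ->
  Num.sqrt C * a = pi * hypergeo2F1 (1 / 4) (3 / 4) 1 (k ^+ 2).
Proof.
move=> a0 C0 k01 hy dy0 yb ode ylo yhi.
have /andP[k0 k1] := k01.
pose th x := asin (y x).
have sC : 0 < Num.sqrt C by rewrite sqrtr_gt0.
pose err N := N%:R * k ^+ N / Num.sqrt (1 - k).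
have hH N x : 0 < x < a ->
    is_derive x 1 (fun x => sin_sum k N (th x)) (Num.sqrt C * (Num.sqrt (1 - k * y x) * bsum N (k * y x))).
  move=> hx; have /andP[y1 y2] := yb x hx.
  have h1 : is_derive x 1 th ((Num.sqrt (1 - y x ^+ 2))^-1 * dy x).
    exact: (is_derive1_comp (is_derive1_asin (yb x hx)) (hy x hx)).
  have h2 := is_derive1_comp (sin_sum_derive k N (th x)) h1.
  apply: is_derive_eq h2 _; rewrite /th asinK ?in_itv/= ?(ltW y1) ?(ltW y2)//.
  have p1 : 0 < 1 - k * y x.
    by rewrite subr_gt0 (@lt_trans _ _ k)// gtr_pMr.
  have p2 : 0 < 1 - y x ^+ 2.
    by rewrite (_ : _ - _ = (1 - y x) * (y x - -1)); [rewrite mulr_gt0// subr_gt0|ring].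
  have -> : dy x = Num.sqrt C * Num.sqrt (1 - k * y x) * Num.sqrt (1 - y x ^+ 2).
    rewrite -!sqrtrM ?mulr_ge0 ?(ltW C0) ?(ltW p1)// -ode// sqrtr_sqr gtr0_norm//.
    exact: dy0.
  have : Num.sqrt (1 - y x ^+ 2) != 0 by rewrite gt_eqF// sqrtr_gt0.
  by move: (Num.sqrt (1 - y x ^+ 2)) => q q0; field.
(* Nothing is assumed about y at 0 and a. The mean value theorem is used on [A, B] inside (0, a),
   and A and B then approach the ends: [thlo] and [thhi] put th A and th B within h of -pi/2 and
   pi/2, and the Lipschitz bound [lip] transfers this to T. *)
have est N : `|sin_sum k N.+1 (pi / 2) - sin_sum k N.+1 (- (pi / 2)) - Num.sqrt C * a| <= Num.sqrt C * a * err N.+1.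
  pose T := sin_sum k N.+1; pose e := Num.sqrt C * err N.+1.
  have e0 : 0 <= e.
    by rewrite mulr_ge0 ?(ltW sC)// divr_ge0 ?sqrtr_ge0// mulr_ge0 ?exprn_ge0// ltW.
  have mvtH A B : 0 < A -> A < B -> B < a -> `|T (th B) - T (th A) - Num.sqrt C * (B - A)| <= e * (B - A).
    move=> A0 AB Ba.
    have [x [/andP[x1 x2] ->]] := is_derive_MVT (hH N.+1) A0 AB Ba.
    have hx : 0 < x < a by rewrite (lt_trans A0) ?(lt_trans x2).
    have /andP[y1 y2] := yb x hx.
    have ks : `|k * y x| <= k.
      by rewrite normrM gtr0_norm// ger_pMr// ler_norml (ltW y1) (ltW y2).
    rewrite -mulrBl -{2}[Num.sqrt C]mulr1 -mulrBr normrM (@ger0_norm _ (B - A)) ?subr_ge0 ?(ltW AB)//.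
    rewrite ler_wpM2r ?subr_ge0 ?(ltW AB)// normrM gtr0_norm// ler_wpM2l ?(ltW sC)//.
    exact: bsum_bound.
  have lip (t s : R) : `|T t - T s| <= N.+1%:R * `|t - s|.
    have hT (u : R) : is_derive u 1 T (bsum N.+1 (k * sin u)) := sin_sum_derive k N.+1 u.
    have bT (u : R) : `|bsum N.+1 (k * sin u)| <= N.+1%:R.
      apply: le_trans (ler_norm_sum _ _ _) _.
      rewrite -[X in _ <= X%:R](card_ord N.+1) -sum1_card natr_sum ler_sum// => i _.
      rewrite normrM normrX normrM (gtr0_norm k0) (ger0_norm (bcoef_ge0 R i)).
      apply: mulr_ile1 => //; rewrite ?bcoef_ge0 ?bcoef_le1 ?exprn_ge0 ?mulr_ge0 ?(ltW k0)//.
      rewrite exprn_ile1 ?mulr_ge0 ?(ltW k0)//.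
      by rewrite mulr_ile1 ?(ltW k0) ?(ltW k1)// ler_norml sin_geN1 sin_le1.
    have lt_lip (u v : R) : u < v -> `|T u - T v| <= N.+1%:R * `|u - v|.
      move=> uv; have [x [_]] := @is_derive_MVT _ T _ (u - 1) (v + 1) u v (fun x _ => hT x)
        (ltac:(lra)) uv (ltac:(lra)).
      by rewrite distrC => ->; rewrite normrM (distrC u) ler_wpM2r.
    have [ts|st|->] := ltgtP t s; first exact: lt_lip.
      by rewrite distrC (distrC t) lt_lip.
    by rewrite !subrr normr0 mulr0.
  have thlo (h : R) : 0 < h -> h <= 1 -> exists x, [/\ 0 < x, x < a / 2, x < h & `|th x + pi / 2| <= h].
    move=> h0 h1; have p1 := pi_gt0 R; have p2 := pi_ge2 R.
    pose s := sin (- (pi / 2) + h).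
    have s1 : -1 < s.
      rewrite -(sin_pihalf R) -sinN ltr_sin ?in_itv/=; [lra| |]; apply/andP; split; lra.
    have m0 : 0 < Num.min (s + 1) (Num.min h (a / 2)) by rewrite !lt_min h0 divr_gt0// andbT; lra.
    have [x [x0 xa]] := ylo _ m0; rewrite !lt_min => /and3P[_ xh xa2] hyx.
    have hys : y x < s.
      have : Num.min (s + 1) (Num.min h (a / 2)) <= s + 1 by rewrite ge_min lexx.
      lra.
    exists x; split => //.
    have /andP[y1 y2] := yb x (introT andP (conj x0 xa)).
    have yI : -1 <= y x <= 1 by rewrite !ltW.
    have t1 := asin_geNpi2 yI; have t2 := asin_lepi2 yI.
    rewrite /th ger0_norm; last by lra.
    rewrite leNgt; apply/negP => hc.
    have : sin (- (pi / 2) + h) < sin (asin (y x)).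
      by rewrite ltr_sin ?in_itv/= ?t1 ?t2//; [lra|apply/andP; split; lra].
    by rewrite asinK ?in_itv//= -/s; lra.
  have thhi (h : R) : 0 < h -> h <= 1 -> exists x, [/\ a / 2 < x, x < a, a - h < x & `|th x - pi / 2| <= h].
    move=> h0 h1; have p1 := pi_gt0 R; have p2 := pi_ge2 R.
    pose s := sin (pi / 2 - h).
    have s1 : s < 1.
      rewrite -(sin_pihalf R) ltr_sin ?in_itv/=; [lra| |]; apply/andP; split; lra.
    have m0 : 0 < Num.min (1 - s) (Num.min h (a / 2)) by rewrite !lt_min h0 divr_gt0// andbT; lra.
    have [x [x0 xa]] := yhi _ m0; set m := Num.min _ _ in m0 * => xm hyx.
    have m1 : m <= 1 - s by rewrite ge_min lexx.
    have m2 : m <= h by rewrite !ge_min lexx orbT.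
    have m3 : m <= a / 2 by rewrite !ge_min lexx !orbT.
    have hys : s < y x by lra.
    exists x; split => //; [lra|lra|].
    have /andP[y1 y2] := yb x (introT andP (conj x0 xa)).
    have yI : -1 <= y x <= 1 by rewrite !ltW.
    have t1 := asin_geNpi2 yI; have t2 := asin_lepi2 yI.
    rewrite /th distrC ger0_norm; last by lra.
    rewrite leNgt; apply/negP => hc.
    have : sin (asin (y x)) < sin (pi / 2 - h).
      by rewrite ltr_sin ?in_itv/= ?t1 ?t2//; [lra|apply/andP; split; lra].
    by rewrite asinK ?in_itv//= -/s; lra.
  rewrite -mulrA (mulrC a) mulrA -/e -subr_le0.
  (* The excess is at most N + 1 times h at each end, plus sqrt C times 2 h for the missing
     length. *)
  apply: (le_small0 (ltr01 : 0 < 1 :> R) (N := 2 * N.+1%:R + 2 * Num.sqrt C)) => h /andP[h0 h1].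
  have [A [A0 Aa Ah hA]] := thlo h h0 h1; have [B [B0 Ba Bh hB]] := thhi h h0 h1.
  have AB : A < B := lt_trans Aa B0.
  have q1 := mvtH A B A0 AB Ba.
  have q2 : `|T (pi / 2) - T (th B)| <= N.+1%:R * h.
    by apply: le_trans (lip _ _) _; rewrite ler_wpM2l// distrC.
  have q3 : `|T (- (pi / 2)) - T (th A)| <= N.+1%:R * h.
    by apply: le_trans (lip _ _) _; rewrite ler_wpM2l// distrC opprK.
  have q4 : e * (B - A) <= e * a by rewrite ler_wpM2l//; lra.
  have q5 : `|Num.sqrt C * (B - A - a)| <= Num.sqrt C * (2 * h).
    by rewrite normrM gtr0_norm// ler_wpM2l ?(ltW sC)// ler_norml; apply/andP; split; lra.
  rewrite -/T lerBlDl.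
  rewrite (_ : T (pi / 2) - _ - _ = (T (pi / 2) - T (th B)) - (T (- (pi / 2)) - T (th A))
     + (T (th B) - T (th A) - Num.sqrt C * (B - A)) + Num.sqrt C * (B - A - a)); last by ring.
  apply: le_trans (ler_normD _ _) _; have n1 := ler_normD (T (pi / 2) - T (th B) - (T (- (pi / 2)) - T (th A))) (T (th B) - T (th A) - Num.sqrt C * (B - A)).
  have n2 := ler_normB (T (pi / 2) - T (th B)) (T (- (pi / 2)) - T (th A)).
  lra.
pose s n := series (fun n => pochhammer (1 / 4 : R) n * pochhammer (3 / 4) n
               / (pochhammer 1 n * n`!%:R) * (k ^+ 2) ^+ n) n.
have cvs : s @ \oo --> Num.sqrt C * a / pi.
  have p0 := pi_gt0 R; have sk : 0 < Num.sqrt (1 - k) by rewrite sqrtr_gt0 subr_gt0.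
  apply/cvgrPdist_le => e e0.
  have [N0 hN0] := @nat_mul_expr_small R k (e * pi * Num.sqrt (1 - k) / (Num.sqrt C * a)) k01
    (ltac:(by rewrite divr_gt0 ?mulr_gt0)).
  (* The successor makes M positive, so that [est] can be used at the predecessor of 2 M. *)
  exists N0.+1 => // M /= hM.
  have := est (M.*2.-1); rewrite prednK; last by rewrite double_gt0 (leq_trans _ hM).
  rewrite sin_sum_pihalf -/(s M) => h.
  have hM2 : M.*2%:R * k ^+ M.*2 <= e * pi * Num.sqrt (1 - k) / (Num.sqrt C * a).
    by apply: hN0; rewrite (leq_trans (ltnW hM))// -addnn leq_addr.
  rewrite (_ : _ - s M = - (pi * s M - Num.sqrt C * a) / pi); last first.
    by move: (@pi R) p0 {h} => q q0; field; rewrite gt_eqF.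
  rewrite mulNr normrN normrM normfV (gtr0_norm p0) ler_pdivrMr//.
  apply: le_trans h _; rewrite /err mulrA ler_pdivrMr// mulrC -ler_pdivlMr ?mulr_gt0//.
rewrite /hypergeo2F1 (cvg_lim _ cvs)//.
by rewrite [RHS]mulrC divfK// gt_eqF// pi_gt0.
Qed.

(** * Half-periods from the cubic differential equation *)

Lemma is_derive_within_continuous (R : realType) (f df : R -> R) (c d x y : R) :
  (forall t, c < t < d -> is_derive t 1 f (df t)) -> c < x -> y < d ->
  {within `[x, y], continuous f}.
Proof.
move=> hf cx yd; apply: derivable_within_continuous => t; rewrite in_itv /= => /andP[h1 h2].
have h : is_derive t 1 f (df t) by apply: hf; rewrite (lt_le_trans cx)// (le_lt_trans _ yd).
exact: ex_derive.
Qed.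

Section CubicODE.
(** P and Q stand for the Weierstrass function and S_3 = -P'/2 on the real axis. They are kept
    abstract because the argument serves the lattice and its rotation. *)
Variables (R : realType) (a g4 g6 e1 e2 e3 : R) (P Q : R -> R).
Hypothesis a0 : 0 < a.
Hypothesis P_der : forall x, 0 < x < 2 * a -> is_derive x 1 P (- 2 * Q x).
Hypothesis Q_der : forall x, 0 < x < 2 * a -> is_derive x 1 Q (- 3 * (P x ^+ 2 - 5 * g4)).
Hypothesis Q_sqr : forall x, 0 < x < 2 * a ->
  Q x ^+ 2 = P x ^+ 3 - 15 * g4 * P x - 35 * g6.
Hypothesis P_refl : forall x, 0 < x < 2 * a -> P (2 * a - x) = P x.
Hypothesis Q_mid : Q a = 0.
Hypothesis pole : exists d M : R,
  [/\ 0 < d, d < 2 * a & forall x, 0 < x <= d -> `|P x - x ^- 2| <= M].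
Hypotheses (e12 : e2 < e1) (e23 : e3 < e2) (e_sum : e1 + e2 + e3 = 0).
Hypotheses (e_g4 : e1 * e2 + e1 * e3 + e2 * e3 = - 15 * g4)
  (e_g6 : e1 * e2 * e3 = 35 * g6).

Lemma Q_factor x : 0 < x < 2 * a -> Q x ^+ 2 = (P x - e1) * (P x - e2) * (P x - e3).
Proof.
move=> /Q_sqr ->; rewrite -e_g6.
have -> : 15 * g4 = - (e1 * e2 + e1 * e3 + e2 * e3) by rewrite e_g4; ring.
have -> : e3 = - e1 - e2 by rewrite -[e3](addKr (e1 + e2)) e_sum; ring.
ring.
Qed.

Lemma P_large (m : R) : exists2 d : R, 0 < d & forall x, 0 < x <= d -> m < P x.
Proof.
have [d [M [d0 _ hM]]] := pole.
pose r := `|m + M| + 1; have r1 : 1 <= r by rewrite lerDr.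
have r0 : 0 < r by apply: lt_le_trans r1.
exists (Num.min d r^-1); first by rewrite lt_min d0 invr_gt0.
move=> x; rewrite le_min => /and3P[x0 xd xr].
have hx : 0 < x <= d by rewrite x0.
have := hM x hx; rewrite ler_norml => /andP[h1 _].
have h2 : r <= x^-1 by rewrite -[r]invrK lef_pV2 // posrE// invr_gt0.
have h3 : x^-1 <= x ^- 2.
  by rewrite expr2 invfM ler_peMr ?invr_ge0 ?(ltW x0)// (le_trans r1).
have h4 : m + M < r by rewrite ltr_pwDr// ler_norm.
lra.
Qed.

(** The cubic in P is a square, hence nonnegative, so P takes no value strictly between e2 and e1.
    As P is large near 0, the intermediate value theorem keeps it above this gap. *)
Lemma P_ge_e1 x : 0 < x < 2 * a -> e1 <= P x.
Proof.
have h12 := e12; have h23 := e23; have ha := a0.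
move=> hx; have /andP[x0 xa] := hx; rewrite leNgt; apply/negP => Px.
have fac t (ht : 0 < t < 2 * a) : 0 <= (P t - e1) * ((P t - e2) * (P t - e3)).
  by rewrite mulrA -Q_factor// sqr_ge0.
have Px2 : P x <= e2.
  rewrite leNgt; apply/negP => P2; have := fac x hx.
  rewrite nmulr_rge0 ?subr_lt0// leNgt => /negP; apply.
  by rewrite mulr_gt0 ?subr_gt0// (lt_trans e23).
have [d d0 hd] := P_large e1.
pose y := Num.min d (x / 2).
have y0 : 0 < y by rewrite lt_min d0 divr_gt0.
have yx : y < x by rewrite gt_min ltr_pdivrMr// ltr_pMr// ltr1n orbT.
have Py : e1 < P y by apply: hd; rewrite y0 ge_min lexx.
have hc : {within `[y, x], continuous P} := is_derive_within_continuous P_der y0 xa.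
have [| t] := @IVT R P y x ((e1 + e2) / 2) (ltW yx) hc.
  rewrite ge_min le_max; apply/andP; split; apply/orP; [right|left]; lra.
rewrite in_itv /= => /andP[t1 t2] Pt.
have := fac t (introT andP (conj (lt_le_trans y0 t1) (le_lt_trans t2 xa))); rewrite Pt.
rewrite leNgt => /negP; apply; rewrite nmulr_rlt0; last by lra.
by rewrite mulr_gt0//; lra.
Qed.

Lemma Q0_P x : 0 < x < 2 * a -> Q x = 0 -> P x = e1.
Proof.
move=> hx Q0; have := Q_factor hx; rewrite Q0 expr0n/= => /esym/eqP.
have := P_ge_e1 hx; rewrite !mulf_eq0 !subr_eq0 => h /orP[/orP[/eqP//|/eqP h2]|/eqP h3].
  by move: h; rewrite h2 leNgt e12.
by move: h; rewrite h3 leNgt (lt_trans e23).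
Qed.

(** Three times this number is the derivative of the cubic at its simple root e1, and Q' is -3 times
    it wherever P = e1. *)
Lemma e1_simple : e1 ^+ 2 - 5 * g4 <> 0.
Proof.
move=> h.
have : (e1 - e2) * (e1 - e3) = 3 * (e1 ^+ 2 - 5 * g4).
  have -> : 3 * (e1 ^+ 2 - 5 * g4) = 3 * e1 ^+ 2 + (e1 * e2 + e1 * e3 + e2 * e3) by rewrite e_g4; ring.
  have -> : e3 = - e1 - e2 by rewrite -[e3](addKr (e1 + e2)) e_sum; ring.
  ring.
rewrite h mulr0 => /eqP; apply/negP; rewrite gt_eqF// mulr_gt0 ?subr_gt0//.
exact: lt_trans e23 e12.
Qed.

(* Two zeros of Q symmetric about a would force P to be constant between them,
   the value of P at an interior maximum being again e1. *)
Lemma Q_neq0 x : 0 < x < a -> Q x <> 0.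
Proof.
have h12 := e12; have h23 := e23; have ha := a0.
move=> /andP[x0 xa] Qx.
have hx : 0 < x < 2 * a by rewrite x0 (lt_trans xa)// ltr_pMl// ltr1n.
have Px := Q0_P hx Qx.
have in2 t : x <= t -> t <= 2 * a - x -> 0 < t < 2 * a.
  by move=> h1 h2; apply/andP; split; lra.
have hc : {within `[x, 2 * a - x], continuous P}.
  by apply: is_derive_within_continuous P_der x0 _; lra.
have [|c] := EVT_max _ hc; first by lra.
rewrite in_itv /= => /andP[c1 c2] cmax.
have Pc : P c = e1.
  have [->//|cx] := eqVneq c x.
  have [->|cx'] := eqVneq c (2 * a - x); first by rewrite P_refl.
  have c3 : x < c by rewrite lt_def cx.
  have c4 : c < 2 * a - x by rewrite lt_def eq_sym cx'.
  apply: Q0_P; first exact: in2.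
  have h1 := P_der (in2 c c1 c2).
  have h2 : is_derive c 1 P 0.
    apply: (@derive1_at_max _ P x (2 * a - x)); first by lra.
    - move=> t; rewrite in_itv /= => /andP[t1 t2].
      by have h := P_der (in2 t (ltW t1) (ltW t2)); exact: ex_derive.
    - by rewrite in_itv /= c3.
    - by move=> t; rewrite in_itv /= => /andP[t1 t2]; apply: cmax; rewrite in_itv /= !ltW.
  have : - 2 * Q c = 0 by rewrite -(@derive_val _ _ _ _ _ _ _ h1) (@derive_val _ _ _ _ _ _ _ h2).
  by move=> /eqP; rewrite mulf_eq0 oppr_eq0 pnatr_eq0 => /eqP.
have ha2 : a < 2 * a by rewrite ltr_pMl// ltr1n.
(* Q vanishes at x and at a, so Q' vanishes at some t in between. There P t = e1, against
   [e1_simple]. *)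
have [t [/andP[t1 t2]]] := is_derive_MVT Q_der x0 xa ha2.
have t3 : t <= 2 * a - x by lra.
have ht := in2 t (ltW t1) t3.
have Pt : P t = e1.
  apply/eqP; rewrite eq_le (P_ge_e1 ht) andbT -Pc cmax//.
  by rewrite in_itv /= (ltW t1).
rewrite Q_mid Qx subrr Pt => /esym/eqP; rewrite mulf_eq0 [_ - _ == _]gt_eqF ?subr_gt0// orbF.
by rewrite mulf_eq0 oppr_eq0 pnatr_eq0 /= => /eqP; exact: e1_simple.
Qed.

(** Q has no zero on (0, a), so a negative value at x persists down to 0. P would then increase on
    (0, x], contrary to its pole at 0. *)
Lemma Q_gt0 x : 0 < x < a -> 0 < Q x.
Proof.
have h12 := e12; have h23 := e23; have ha := a0.
move=> hx; have /andP[x0 xa] := hx; rewrite ltNge; apply/negP => Qx.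
have ha2 : a < 2 * a by rewrite ltr_pMl// ltr1n.
have Qneg t : 0 < t <= x -> Q t < 0.
  move=> /andP[t0 tx]; rewrite ltNge; apply/negP => Qt.
  have hc : {within `[t, x], continuous Q}.
    by apply: is_derive_within_continuous Q_der t0 _; lra.
  have [|s] := @IVT R Q t x 0 tx hc.
    by rewrite ge_min le_max Qt Qx orbT.
  rewrite in_itv /= => /andP[s1 s2]; apply: Q_neq0.
  by rewrite (lt_le_trans t0)// (le_lt_trans s2).
have [d d0 hd] := P_large (P x).
pose y := Num.min d (x / 2).
have y0 : 0 < y by rewrite lt_min d0 divr_gt0.
have yx : y < x by rewrite gt_min ltr_pdivrMr// ltr_pMr// ltr1n orbT.
have Py : P x < P y by apply: hd; rewrite y0 ge_min lexx.
have [t [/andP[t1 t2] h]] := is_derive_MVT P_der y0 yx (lt_trans xa ha2).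
have : 0 < (- 2 * Q t) * (x - y).
  by rewrite mulr_gt0 ?subr_gt0// nmulr_rgt0 ?Qneg ?oppr_lt0// (lt_trans y0)//= ltW.
by rewrite -h subr_gt0 ltNge (ltW Py).
Qed.

Lemma P_gt_e1 x : 0 < x < a -> e1 < P x.
Proof.
move=> hx; have /andP[x0 xa] := hx.
have hx2 : 0 < x < 2 * a by rewrite x0 (lt_trans xa)// ltr_pMl// ltr1n.
rewrite lt_def P_ge_e1// andbT; apply/eqP => h.
have := Q_factor hx2; rewrite h subrr !mul0r => /eqP; rewrite sqrf_eq0 gt_eqF//.
exact: Q_gt0.
Qed.

Lemma P_mid : P a = e1.
Proof. by apply: Q0_P; rewrite // a0 ltr_pMl// ltr1n. Qed.

Lemma P_near_mid (e : R) : 0 < e ->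
  exists x, [/\ 0 < x, x < a, a - e < x & P x < e1 + e].
Proof.
have h12 := e12; have h23 := e23; have ha := a0.
move=> e0; have ha2 : 0 < a < 2 * a by rewrite a0 ltr_pMl// ltr1n.
have hP := P_der ha2.
have : {for a, continuous P}.
  by apply: differentiable_continuous; apply/derivable1_diffP; exact: ex_derive.
move=> /cvgrPdist_lt/(_ e e0); rewrite near_simpl => -[d /= d0 hd].
pose h := Num.min (d / 2) (Num.min (e / 2) (a / 2)).
have h0 : 0 < h by rewrite !lt_min !divr_gt0.
have h1 : h <= d / 2 by rewrite ge_min lexx.
have h2 : h <= e / 2 by rewrite !ge_min lexx orbT.
have h3 : h <= a / 2 by rewrite !ge_min lexx !orbT.
exists (a - h); split; [lra|lra|lra|].
have := hd (a - h); rewrite /ball_ /= opprB addrC subrK gtr0_norm// => /(_ ltac:(lra)).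
by rewrite P_mid ltr_norml => /andP[h4 _]; lra.
Qed.

End CubicODE.

(** * Reduction of both periods to the time integral *)

Lemma is_derive_addc (R : realType) (f : R -> R) (x df c : R) :
  is_derive x 1 f df -> is_derive x 1 (fun t => f t + c) df.
Proof. by move=> h; have := is_deriveD h (is_derive_cst c x 1); rewrite addr0. Qed.

Lemma compl_modulus (R : realType) (k : R) : 0 < k < 1 ->
  exists k' : R, [/\ 0 < k', k' < 1 & k' ^+ 2 = 1 - k ^+ 2].
Proof.
move=> /andP[k0 k1]; have k2 : 0 < 1 - k ^+ 2.
  by rewrite subr_gt0 expr_lt1// ltW.
exists (Num.sqrt (1 - k ^+ 2)); split; first by rewrite sqrtr_gt0.
  rewrite -[ltRHS]sqrtr1 ltr_sqrt// gtrDl oppr_lt0 exprn_gt0//.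
by rewrite sqr_sqrtr// ltW.
Qed.

(** The Moebius function of P sending infinity, e1 and e3 to -1, 1 and infinity has the parameter (1
    - k') / (1 + 3 k') in place of k. This is why y has degree two in P here. *)
Lemma rect_period_real (R : realType) (a b k : R) : 0 < a -> 0 < b -> 0 < k < 1 ->
  60 * eis_coef_re a b 4 = 4 / 3 - k ^+ 2 -> 140 * eis_coef_re a b 6 = 8 / 27 - k ^+ 2 / 3 ->
  2 * a = pi * hypergeo2F1 (1 / 4) (3 / 4) 1 (k ^+ 2).
Proof.
move=> a0 b0 k01 g4 g6; have /andP[k0 k1] := k01.
have [k' [k'0 k'1 kk]] := compl_modulus k01.
pose P := wp_re a b; pose Q x := eis_sum_re a b x 3.
pose e1 : R := 6^-1 + k' / 2; pose e2 : R := 6^-1 - k' / 2; pose e3 : R := - 3^-1.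
have e12 : e2 < e1 by rewrite /e1 /e2; lra.
have e23 : e3 < e2 by rewrite /e3 /e2; lra.
have es : e1 + e2 + e3 = 0 by rewrite /e1 /e2 /e3; field.
have eg4 : e1 * e2 + e1 * e3 + e2 * e3 = - 15 * eis_coef_re a b 4.
  rewrite (_ : - 15 * eis_coef_re a b 4 = - (60 * eis_coef_re a b 4) / 4); last by field.
  rewrite g4 (_ : k ^+ 2 = 1 - k' ^+ 2); last by rewrite kk; ring.
  by rewrite /e1 /e2 /e3; field.
have eg6 : e1 * e2 * e3 = 35 * eis_coef_re a b 6.
  rewrite (_ : 35 * eis_coef_re a b 6 = (140 * eis_coef_re a b 6) / 4); last by field.
  rewrite g6 (_ : k ^+ 2 = 1 - k' ^+ 2); last by rewrite kk; ring.
  by rewrite /e1 /e2 /e3; field.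
have Pd x : 0 < x < 2 * a -> is_derive x 1 P (- 2 * Q x) by exact: P_derive.
have Qd x : 0 < x < 2 * a -> is_derive x 1 Q (- 3 * (P x ^+ 2 - 5 * eis_coef_re a b 4)).
  move=> hx; have [<- _] := S3_wp_cubic a0 b0 hx; exact: (@Sr_derive R a b a0 b0 x 3 isT).
have Q2 x : 0 < x < 2 * a -> Q x ^+ 2 = P x ^+ 3 - 15 * eis_coef_re a b 4 * P x - 35 * eis_coef_re a b 6.
  by move=> hx; have [_] := S3_wp_cubic a0 b0 hx.
have Pr x : 0 < x < 2 * a -> P (2 * a - x) = P x by exact: P_sym.
have Qm : Q a = 0 by exact: Sr_mid.
have pl : exists d M : R, [/\ 0 < d, d < 2 * a & forall x, 0 < x <= d -> `|P x - x ^- 2| <= M].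
  exact: P_pole.
clearbody P Q; move: (eis_coef_re a b 4) (eis_coef_re a b 6) g4 g6 eg4 eg6 Qd Q2 => G4 G6 g4 g6 eg4 eg6 Qd Q2.
have Qpos := Q_gt0 a0 Pd Qd Q2 Pr Qm pl e12 e23 es eg4 eg6.
have Pgt := P_gt_e1 a0 Pd Qd Q2 Pr Qm pl e12 e23 es eg4 eg6.
have Pmid := P_near_mid a0 Pd Q2 Qm pl e12 e23 es eg4 eg6.
have fac := Q_factor Q2 es eg4 eg6.
have in2 x : 0 < x < a -> 0 < x < 2 * a.
  by move=> /andP[x0 xa]; rewrite x0 (lt_trans xa)// ltr_pMl// ltr1n.
pose q x := P x + 3^-1.
(* Landen's transformation: y is a Moebius function of q + k^2 / (4 q), which is
   up to a constant the Weierstrass function of the lattice with half the imaginary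
   period. *)
pose z x := 2 * (1 + k) * (q x * (q x + k / 2)^-1 ^+ 2).
pose y x := z x + -1.
(* 1 - k y = (1 + k) ((q - k/2) / (q + k/2))^2 is a multiple of a square, 1 - y = 2 (q^2 - q +
   k^2/4) / (q + k/2)^2, and Q^2 = q (q^2 - q + k^2/4); together they give C = 4. *)
pose dy x := 4 * (1 + k) * (q x - k / 2) * Q x / (q x + k / 2) ^+ 3.
have qlo x : 0 < x < a -> (1 + k') / 2 < q x.
  by move=> /Pgt; rewrite /q /e1; lra.
have four : 2 = Num.sqrt 4 :> R by rewrite (_ : 4 = 2 ^+ 2); [rewrite sqrtr_sqr ger0_norm|ring].
clear Q2 Qd Pr Qm g4 g6 eg4 eg6 es.
rewrite [in LHS]four; apply: (@hypergeo_time R a 4 k y dy a0 (ltr0n R 4) k01).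
- move=> x hx; have h := qlo x hx; have hP := Pd x (in2 x hx).
  have r0 : q x + k / 2 != 0 by apply: lt0r_neq0; lra.
  have hq : is_derive x 1 q (- 2 * Q x) by exact: is_derive_addc.
  have hr : is_derive x 1 (fun x => q x + k / 2) (- 2 * Q x) by exact: is_derive_addc.
  have hV := @is_deriveV R (fun x => q x + k / 2) x _ 1 r0 hr.
  have hM := is_deriveM hq (is_derive_powf 2 hV).
  have hZ := is_deriveZ (2 * (1 + k)) hM.
  apply: is_derive_eq (is_derive_addc (-1) hZ) _.
  rewrite /GRing.scale /= /dy; move: (q x) (Q x) h => X Y h.
  by field; apply: lt0r_neq0; lra.
- move=> x hx; have h := qlo x hx; have hQ := Qpos x hx.
  by rewrite /dy divr_gt0 ?exprn_gt0 ?mulr_gt0 ?subr_gt0//; lra.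
- move=> x hx; have h := qlo x hx.
  have r0 : 0 < q x + k / 2 by lra.
  have z0 : 0 < z x by rewrite /z !mulr_gt0 ?exprn_gt0 ?invr_gt0//; lra.
  have : 0 < (q x - (1 + k') / 2) * (q x - (1 - k') / 2) by rewrite mulr_gt0//; lra.
  rewrite (_ : _ * _ = q x ^+ 2 - q x + (1 - k' ^+ 2) / 4); last by field.
  rewrite kk opprB addrCA subrr addr0 => hm.
  have z2 : z x < 2.
    rewrite /z exprVn mulrA ltr_pdivrMr ?exprn_gt0//.
    rewrite -subr_gt0 (_ : _ - _ = 2 * (q x ^+ 2 - q x + k ^+ 2 / 4)); last by field.
    by rewrite mulr_gt0.
  by rewrite /y; apply/andP; split; lra.
- move=> x hx; have h := qlo x hx; have r0 : q x + k / 2 != 0 by apply: lt0r_neq0; lra.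
  have hf : Q x ^+ 2 = q x * (q x ^+ 2 - q x + k ^+ 2 / 4).
    rewrite fac ?in2// (_ : k ^+ 2 = 1 - k' ^+ 2); last by rewrite kk; ring.
    by rewrite /q /e1 /e2 /e3; field.
  rewrite /dy expr_div_n exprMn hf /y /z; move: (q x) h => X h; field.
  by apply: lt0r_neq0; lra.
- move=> e e0; have [d d0 hd] := P_large pl (4 / e).
  pose x := Num.min (d / 2) (Num.min (a / 2) (e / 2)).
  have x0 : 0 < x by rewrite !lt_min !divr_gt0.
  have x1 : x <= d / 2 by rewrite ge_min lexx.
  have x2 : x <= a / 2 by rewrite !ge_min lexx orbT.
  have x3 : x <= e / 2 by rewrite !ge_min lexx !orbT.
  exists x; split => //; [lra|lra|].
  have hx : 0 < x <= d by rewrite x0; lra.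
  have hP := hd x hx; rewrite /y addrC ltrD2l /z.
  have e4 : 0 < 4 / e by rewrite divr_gt0.
  have hq : 4 / e < q x by rewrite /q; lra.
  have q0 : 0 < q x by lra.
  have r0 : 0 < q x + k / 2 by lra.
  rewrite exprVn mulrA ltr_pdivrMr ?exprn_gt0//.
  have h1 : 4 < e * q x by rewrite -ltr_pdivrMl// mulrC.
  have h2 : 4 * q x < e * q x * q x by rewrite ltr_pM2r.
  have h3 : e * q x * q x <= e * (q x + k / 2) ^+ 2.
    rewrite -mulrA ler_pM2l// -expr2 lerXn2r ?nnegrE ?(ltW q0) ?(ltW r0)//; lra.
  have h4 : 2 * (1 + k) * q x < 4 * q x by rewrite ltr_pM2r//; lra.
  lra.
(* In 1 - y the two factors of q^2 - q + k^2/4 are below d and 2, and the denominator is at least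
   1/4; so 1 - y < 16 d <= e. *)
- move=> e e0; pose d := Num.min (e / 16) 1.
  have d0 : 0 < d by rewrite lt_min divr_gt0/= ?ltr01.
  have d1 : d <= e / 16 by rewrite ge_min lexx.
  have d2 : d <= 1 by rewrite ge_min lexx orbT.
  have [x [x0 xa xd hx]] := Pmid d d0.
  exists x; split => //; first by lra.
  have hx1 : 0 < x < a by rewrite x0.
  have h := qlo x hx1; have r0 : 0 < q x + k / 2 by lra.
  have q1 : 2^-1 < q x by lra.
  have hq : q x < (1 + k') / 2 + d by move: hx; rewrite /q /e1; lra.
  rewrite -subr_gt0 /y /z exprVn (_ : _ - _ =
     (e * (q x + k / 2) ^+ 2 - 2 * (q x ^+ 2 - q x + k ^+ 2 / 4)) / (q x + k / 2) ^+ 2); last first.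
    by move: (q x) q1 => X q1; field; apply: lt0r_neq0; lra.
  rewrite divr_gt0 ?exprn_gt0// subr_gt0.
  rewrite (_ : q x ^+ 2 - _ + _ = (q x - (1 + k') / 2) * (q x - (1 - k') / 2)); last first.
    by rewrite (_ : k ^+ 2 = 1 - k' ^+ 2); [field|rewrite kk; ring].
  have hD : 4^-1 <= (q x + k / 2) ^+ 2.
    rewrite (_ : 4^-1 = 2^-1 ^+ 2); last by field.
    rewrite lerXn2r ?nnegrE ?(ltW r0)//; lra.
  have hm : (q x - (1 + k') / 2) * (q x - (1 - k') / 2) < d * 2.
    by rewrite ltr_pM//; lra.
  have : e * 4^-1 <= e * (q x + k / 2) ^+ 2 by rewrite ler_pM2l.
  lra.
Qed.

(** Applied to the rotated lattice, so a is the modulus of the imaginary half-period and the roots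
    are the negatives of those in [rect_period_real]. Here y is the Moebius function of P sending
    infinity, e1, e2, e3 to -1, 1, 1 / k', infinity. *)
Lemma rect_period_imag (R : realType) (a b k : R) : 0 < a -> 0 < b -> 0 < k < 1 ->
  60 * eis_coef_re a b 4 = 4 / 3 - k ^+ 2 -> 140 * eis_coef_re a b 6 = - (8 / 27 - k ^+ 2 / 3) ->
  Num.sqrt 2 * a = pi * hypergeo2F1 (1 / 4) (3 / 4) 1 (1 - k ^+ 2).
Proof.
move=> a0 b0 k01 g4 g6; have /andP[k0 k1] := k01.
have [k' [k'0 k'1 kk]] := compl_modulus k01.
pose P := wp_re a b; pose Q x := eis_sum_re a b x 3.
pose e1 : R := 3^-1; pose e2 : R := k' / 2 - 6^-1; pose e3 : R := - 6^-1 - k' / 2.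
have e12 : e2 < e1 by rewrite /e1 /e2; lra.
have e23 : e3 < e2 by rewrite /e3 /e2; lra.
have es : e1 + e2 + e3 = 0 by rewrite /e1 /e2 /e3; field.
have eg4 : e1 * e2 + e1 * e3 + e2 * e3 = - 15 * eis_coef_re a b 4.
  rewrite (_ : - 15 * eis_coef_re a b 4 = - (60 * eis_coef_re a b 4) / 4); last by field.
  rewrite g4 (_ : k ^+ 2 = 1 - k' ^+ 2); last by rewrite kk; ring.
  by rewrite /e1 /e2 /e3; field.
have eg6 : e1 * e2 * e3 = 35 * eis_coef_re a b 6.
  rewrite (_ : 35 * eis_coef_re a b 6 = (140 * eis_coef_re a b 6) / 4); last by field.
  rewrite g6 (_ : k ^+ 2 = 1 - k' ^+ 2); last by rewrite kk; ring.
  by rewrite /e1 /e2 /e3; field.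
have Pd x : 0 < x < 2 * a -> is_derive x 1 P (- 2 * Q x) by exact: P_derive.
have Qd x : 0 < x < 2 * a -> is_derive x 1 Q (- 3 * (P x ^+ 2 - 5 * eis_coef_re a b 4)).
  move=> hx; have [<- _] := S3_wp_cubic a0 b0 hx; exact: (@Sr_derive R a b a0 b0 x 3 isT).
have Q2 x : 0 < x < 2 * a -> Q x ^+ 2 = P x ^+ 3 - 15 * eis_coef_re a b 4 * P x - 35 * eis_coef_re a b 6.
  by move=> hx; have [_] := S3_wp_cubic a0 b0 hx.
have Pr x : 0 < x < 2 * a -> P (2 * a - x) = P x by exact: P_sym.
have Qm : Q a = 0 by exact: Sr_mid.
have pl : exists d M : R, [/\ 0 < d, d < 2 * a & forall x, 0 < x <= d -> `|P x - x ^- 2| <= M].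
  exact: P_pole.
clearbody P Q; move: (eis_coef_re a b 4) (eis_coef_re a b 6) g4 g6 eg4 eg6 Qd Q2 => G4 G6 g4 g6 eg4 eg6 Qd Q2.
have Qpos := Q_gt0 a0 Pd Qd Q2 Pr Qm pl e12 e23 es eg4 eg6.
have Pgt := P_gt_e1 a0 Pd Qd Q2 Pr Qm pl e12 e23 es eg4 eg6.
have Pmid := P_near_mid a0 Pd Q2 Qm pl e12 e23 es eg4 eg6.
have fac := Q_factor Q2 es eg4 eg6.
have in2 x : 0 < x < a -> 0 < x < 2 * a.
  by move=> /andP[x0 xa]; rewrite x0 (lt_trans xa)// ltr_pMl// ltr1n.
have k'01 : 0 < k' < 1 by rewrite k'0.
(* Translating by the half-period where P takes the value e3 turns P into a function
   with values in [e3, e2], which y rescales to [-1, 1]. *)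
pose r x := P x - e3.
pose y x := (1 + k') * (r x)^-1 + -1.
pose dy x := 2 * (1 + k') * Q x / r x ^+ 2.
have rlo x : 0 < x < a -> (1 + k') / 2 < r x.
  by move=> /Pgt; rewrite /r /e1 /e3; lra.
clear Q2 Qd Pr Qm g4 g6 eg4 eg6 es.
rewrite -kk; apply: (@hypergeo_time R a 2 k' y dy a0 (ltr0n R 2) k'01).
- move=> x hx; have h := rlo x hx; have hP := Pd x (in2 x hx).
  have r0 : r x != 0 by apply: lt0r_neq0; lra.
  have hr : is_derive x 1 r (- 2 * Q x) by exact: is_derive_addc.
  have hV := @is_deriveV R r x _ 1 r0 hr.
  have hZ := is_deriveZ (1 + k') hV.
  apply: is_derive_eq (is_derive_addc (-1) hZ) _.
  rewrite /GRing.scale /= /dy; move: (r x) (Q x) r0 => X Y r0.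
  by field.
- move=> x hx; have h := rlo x hx; have hQ := Qpos x hx.
  by rewrite /dy divr_gt0 ?exprn_gt0 ?mulr_gt0//; lra.
- move=> x hx; have h := rlo x hx; have r0 : 0 < r x by lra.
  have z0 : 0 < (1 + k') * (r x)^-1 by rewrite divr_gt0//; lra.
  have z2 : (1 + k') * (r x)^-1 < 2 by rewrite ltr_pdivrMr//; lra.
  by rewrite /y; apply/andP; split; lra.
- move=> x hx; have h := rlo x hx.
  have hf : Q x ^+ 2 = r x * (r x - k') * (r x - (1 + k') / 2).
    by rewrite fac ?in2// /r /e1 /e2 /e3; field.
  rewrite /dy expr_div_n exprMn hf /y; move: (r x) h => X h; field.
  by apply: lt0r_neq0; lra.
- move=> e e0; have [d d0 hd] := P_large pl (4 / e).
  pose x := Num.min (d / 2) (Num.min (a / 2) (e / 2)).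
  have x0 : 0 < x by rewrite !lt_min !divr_gt0.
  have x1 : x <= d / 2 by rewrite ge_min lexx.
  have x2 : x <= a / 2 by rewrite !ge_min lexx orbT.
  have x3 : x <= e / 2 by rewrite !ge_min lexx !orbT.
  exists x; split => //; [lra|lra|].
  have hx : 0 < x <= d by rewrite x0; lra.
  have hP := hd x hx; rewrite /y addrC ltrD2l.
  have e4 : 0 < 4 / e by rewrite divr_gt0.
  have hq : 4 / e < r x by rewrite /r /e3; lra.
  have q0 : 0 < r x by lra.
  rewrite ltr_pdivrMr//.
  have h1 : 4 < e * r x by rewrite -ltr_pdivrMl// mulrC.
  lra.
- move=> e e0; pose d := e / 8.
  have d0 : 0 < d by rewrite divr_gt0.
  have [x [x0 xa xd hx]] := Pmid d d0.
  exists x; split => //; first by rewrite /d in xd; lra.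
  have hx1 : 0 < x < a by rewrite x0.
  have h := rlo x hx1; have r0 : 0 < r x by lra.
  have hq : r x < (1 + k') / 2 + d by move: hx; rewrite /r /e1 /e3; lra.
  have q1 : 2^-1 < r x by lra.
  have h1 : e * 2^-1 < e * r x by rewrite ltr_pM2l.
  suff : (2 - e) < (1 + k') * (r x)^-1 by rewrite /y; lra.
  by rewrite ltr_pdivlMr//; rewrite /d in hq; lra.
Qed.

(** * The functions of the statement *)

(** Passes from lattice indices to all complex numbers: the statement sums over [R[i]] a family that
    is zero off the lattice. *)
Lemma is_sum_extend (R : realType) (I J : choiceType) (h : I -> J) (h' : J -> I)
    (g : J -> R[i]) s :
  cancel h h' -> (forall j, h (h' j) != j -> g j = 0) ->
  is_sum (g \o h) s -> is_sum g s.
Proof.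
move=> hK g0 hs e /hs[A hA]; exists [fset h i | i in A]%fset => B AB.
have inj : injective h := can_inj hK.
pose B' := [fset h' j | j in [fset j in B | h (h' j) == j]]%fset.
have AB' : (A `<=` B')%fset.
  apply/fsubsetP => i iA; apply/imfsetP; exists (h i); last by rewrite hK.
  rewrite !inE /= hK eqxx andbT; apply: (fsubsetP AB); exact: in_imfset.
have := hA B' AB'; rewrite big_imfset /=; last first.
  by move=> x y; rewrite !inE /= => /andP[_ /eqP hx] /andP[_ /eqP hy] hxy; rewrite -hx -hy hxy.
suff <- : \sum_(j <- B) g j = \sum_(j <- [fset j in B | h (h' j) == j]%fset) g (h (h' j)) by [].
rewrite (big_fsetID _ (fun j => h (h' j) == j) B) /= [X in _ + X]big_seq [X in _ + X]big1 ?addr0; last first.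
  by move=> j; rewrite !inE /= => /andP[_ /g0].
by rewrite big_seq [RHS]big_seq; apply: eq_bigr => j; rewrite !inE /= => /andP[_ /eqP ->].
Qed.

Section LatticeSum.
Variables (R : realType) (w1 w2 : R[i]).
Hypothesis w12 : complex.Im (w2 / w1) != 0.
Let L := zspan w1 w2.

Lemma zspanE z : L z <-> exists l, z = lattice_pt w1 w2 l.
Proof. by split=> [[m [n ->]]|[[m n] ->]]; [exists (m, n)|exists m, n]. Qed.

Lemma mem_zspan_lam l : lattice_pt w1 w2 l \in L.
Proof. by rewrite inE; apply/zspanE; exists l. Qed.

Lemma lam_inj : injective (lattice_pt w1 w2).
Proof.
move=> l r /eqP; rewrite -subr_eq0 -lamN -lamD lam_eq0// subr_eq0.
by move=> /eqP.
Qed.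

Lemma lattice_sumE (f : R[i] -> R[i]) s :
  is_sum (fun l => if l == 0 then 0 else f (lattice_pt w1 w2 l)) s -> lattice_sum L f = s.
Proof.
move=> hs; apply: summability_sumE.
pose h' (z : R[i]) : int * int := xget 0 [set l | z = lattice_pt w1 w2 l].
have hK : cancel (lattice_pt w1 w2) h'.
  by move=> l; rewrite /h'; case: xgetP => [r _ /lam_inj ->//|/(_ l) /(_ erefl)].
apply: (is_sum_extend hK) => [z hz|].
  case: ifP => // /andP[]; rewrite inE => /zspanE[l zl].
  by move: hz; rewrite zl hK eqxx.
apply: eq_is_sum hs => l /=.
by rewrite mem_zspan_lam lam_eq0//=; case: eqP.
Qed.

Lemma invariant_g2E : invariant_g2 L = 60 * eis_coef w1 w2 4.
Proof.
congr (_ * _); apply: lattice_sumE; apply: eq_is_sum (is_sum_G w12 (isT : (3 <= 4)%N)) => l.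
by case: eqP => [->|_]; rewrite ?lam0 ?invr0 ?expr0n// exprVn.
Qed.

Lemma invariant_g3E : invariant_g3 L = 140 * eis_coef w1 w2 6.
Proof.
congr (_ * _); apply: lattice_sumE; apply: eq_is_sum (is_sum_G w12 (isT : (3 <= 6)%N)) => l.
by case: eqP => [->|_]; rewrite ?lam0 ?invr0 ?expr0n// exprVn.
Qed.

Lemma notin_regular z : z \notin L -> regular w1 w2 z.
Proof. by move=> zL l; apply: contraNneq zL => ->; exact: mem_zspan_lam. Qed.

Lemma weierstrassPE z : z \notin L -> weierstrassP L z = Some (wp_sum w1 w2 z).
Proof.
move=> zL; rewrite /weierstrassP (negPf zL); congr Some.
rewrite (@lattice_sumE _ (wp_sum w1 w2 z - z ^- 2)); first by rewrite addrC subrK.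
have := is_sumB (is_sum_wp w12 (notin_regular zL)) (is_sum_delta 0 (z ^- 2)).
apply: eq_is_sum => l; case: eqP => [->|_]; last by rewrite subr0 /inv_diff !exprVn.
by rewrite /inv_diff lam0 subr0 invr0 expr0n subr0 exprVn subrr.
Qed.

Lemma weierstrassP_None z : weierstrassP L z = None <-> L z.
Proof.
rewrite /weierstrassP; case: ifPn => [|zL]; first by rewrite inE.
by split=> // Lz; move: zL; rewrite notin_setE.
Qed.

(** The poles are exactly the lattice points and 0 is one of them, so a period, being the translate
    of 0, is a lattice point. The converse is [wp_shift]. *)
Lemma periods_weierstrassP : periods (weierstrassP L) = L.
Proof.
apply/seteqP; split=> [w hw|w /zspanE[r ->] z].
  apply/weierstrassP_None; have := hw 0; rewrite add0r => ->.
  by apply/weierstrassP_None/zspanE; exists 0; rewrite lam0.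
have [zL|zL] := boolP (z \in L).
  have [l zl] : exists l, z = lattice_pt w1 w2 l by apply/zspanE; rewrite inE in zL.
  have -> : weierstrassP L z = None by apply/weierstrassP_None; rewrite inE in zL.
  by apply/weierstrassP_None/zspanE; exists (l + r); rewrite zl lamD.
have zrL : z + lattice_pt w1 w2 r \notin L.
  rewrite notin_setE => /zspanE[l hl]; move: zL; rewrite notin_setE; apply.
  by apply/zspanE; exists (l - r); rewrite lamD lamN -hl addrK.
by rewrite !weierstrassPE// wp_shift//; exact: notin_regular.
Qed.
End LatticeSum.

(** For nonzero k, dn_2 is a Moebius function of p, hence injective on the Riemann sphere. *)
Lemma periods_dn2 (R : realType) (k : R) (p : R[i] -> option R[i]) :
  k != 0 -> periods (dn2 k p) = periods p.
Proof.
move=> k0; have k2 : (k ^+ 2 / 2)%:C != 0.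
  by rewrite (inj_eq (@complexI R)) mulf_neq0 ?expf_neq0// invr_eq0 pnatr_eq0.
suff inj z z' : dn2 k p z = dn2 k p z' -> p z = p z'.
  apply/seteqP; split=> w hw z; first by apply: inj; exact: hw.
  by rewrite /dn2 hw.
rewrite /dn2; set c : R[i] := (k ^+ 2 / 2)%:C in k2 *.
case: (p z) (p z') => [v|] [v'|] //.
- case: eqVneq => [e1|n1]; case: eqVneq => [e2|n2] //.
    by move=> _; congr Some; apply: (@addrI _ 3^-1); rewrite e1 e2.
  move=> [/addrI /oppr_inj /(mulfI k2) /invr_inj /addrI ->//].
- by case: eqVneq => // n1 [] /eqP; rewrite -subr_eq0 addrC addrA addNr add0r oppr_eq0 mulf_eq0 (negPf k2) invr_eq0 (negPf n1).
- by case: eqVneq => // n1 [] /eqP; rewrite eq_sym -subr_eq0 addrC addrA addNr add0r oppr_eq0 mulf_eq0 (negPf k2) invr_eq0 (negPf n1).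
Qed.

(** Multiplication by i exchanges the two sides of the rectangle, so each summand picks up the
    factor i^k. *)
Lemma G_rotate (R : realType) (a b : R) k : 0 < a -> 0 < b -> (3 <= k)%N ->
  eis_coef (2 * b)%:C ('i%C * (2 * a)%:C) k = 'i%C ^+ k * eis_coef (2 * a)%:C ('i%C * (2 * b)%:C) k.
Proof.
move=> a0 b0 k3.
pose h (l : int * int) : int * int := (- l.2, l.1).
pose h' (l : int * int) : int * int := (l.2, - l.1).
have hK : cancel h h' by move=> -[m n]; rewrite /h /h' /= opprK.
have h'K : cancel h' h by move=> -[m n]; rewrite /h /h' /= opprK.
apply: (is_sum_unique (is_sum_G (rect_w12 b0 a0) k3)).
have := is_sumZ ('i%C ^+ k) (is_sum_reindex hK h'K (is_sum_G (rect_w12 a0 b0) k3)).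
apply: eq_is_sum => l /=; rewrite -exprMn; congr (_ ^+ k).
have i2 : 'i%C * 'i%C = -1 :> R[i] by rewrite -expr2 sqr_i.
have -> : lattice_pt (2 * a)%:C ('i%C * (2 * b)%:C) (h l) = 'i%C * lattice_pt (2 * b)%:C ('i%C * (2 * a)%:C) l.
  rewrite /lattice_pt /h /= mulrDr (mulrCA 'i%C l.2%:~R) (mulrA 'i%C 'i%C) i2 intrN; ring.
have i0 : 'i%C != 0 :> R[i].
  by apply/eqP => i0; move/eqP: i2; rewrite i0 mul0r eq_sym oppr_eq0 oner_eq0.
by rewrite invfM mulrA mulfV// mul1r.
Qed.

Theorem theorem8 (R : realType) (k : R) (hk : 0 < k < 1)
    (p : R[i] -> option R[i])
    (hp : is_weierstrassP (4 / 3 - k ^+ 2)%:C (8 / 27 - k ^+ 2 / 3)%:C p)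
    (w w' : R[i]) :
  (is_fundamental_pair p (2 * w) (2 * w') <->
   is_fundamental_pair (dn2 k p) (2 * w) (2 * w')) /\
  (is_fundamental_pair p (2 * w) (2 * w') ->
   0 < w -> 0 < - 'i%C * w' ->
   w = (pi / 2 * hypergeo2F1 (1 / 4) (3 / 4) 1 (k ^+ 2))%:C /\
   w' = 'i%C * (Num.sqrt 2 / 2 * pi
                * hypergeo2F1 (1 / 4) (3 / 4) 1 (1 - k ^+ 2))%:C).
Proof.
have /andP[k0 k1] := hk.
split; first by rewrite /is_fundamental_pair periods_dn2// gt_eqF.
move=> [ww' hper] w0 w'0.
have [L [[v1 [v2 [v12 LE]]] hg2 hg3 pE]] := hp.
(* The generators v1, v2 of the given lattice are arbitrary; comparing periods replaces them by the
   pair of the statement. *)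
have Lw : L = zspan (2 * w) (2 * w').
  by rewrite -hper pE LE periods_weierstrassP.
pose a : R := complex.Re w; pose b : R := complex.Re (- 'i%C * w').
have wa : w = a%:C.
  by move: w0; rewrite ltcE /= /a => /andP[/eqP]; case: (w) => x y /= ->.
have wb : w' = 'i%C * b%:C.
  have -> : b%:C = - 'i%C * w'.
    by move: w'0; rewrite ltcE /b => /andP[/eqP]; case: (- 'i%C * w') => x y /= ->.
  by rewrite mulrA mulrN -expr2 sqr_i opprK mul1r.
have a0 : 0 < a by move: w0; rewrite ltcE => /andP[].
have b0 : 0 < b by move: w'0; rewrite ltcE => /andP[].
have e1 : 2 * w = (2 * a)%:C by rewrite wa rmorphM rmorph_nat.
have e2 : 2 * w' = 'i%C * (2 * b)%:C by rewrite wb rmorphM rmorph_nat; ring.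
have w12 := rect_w12 a0 b0.
move: hg2 hg3; rewrite Lw e1 e2 invariant_g2E// invariant_g3E// => hg2 hg3.
have hG4 := hg2; have hG6 := hg3.
rewrite GrE// -(rmorph_nat (real_complex R)) -rmorphM in hG4.
rewrite GrE// -(rmorph_nat (real_complex R)) -rmorphM in hG6.
have {}hG4 := complexI hG4; have {}hG6 := complexI hG6.
(* Rotation keeps g2, as i^4 = 1, and changes the sign of g3, as i^6 = -1. *)
have rG4 : eis_coef_re b a 4 = eis_coef_re a b 4.
  rewrite /eis_coef_re G_rotate// (_ : 'i%C ^+ 4 = 1 :> R[i]) ?mul1r//.
  by rewrite (exprM _ 2 2) sqr_i sqrrN expr1n.
have rG6 : eis_coef_re b a 6 = - eis_coef_re a b 6.
  have i6 : 'i%C ^+ 6 = -1 :> R[i] by rewrite (exprM _ 2 3) sqr_i -signr_odd expr1.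
  by rewrite /eis_coef_re G_rotate// i6 mulN1r; set g := eis_coef _ _ 6; case: g.
have ha := rect_period_real a0 b0 hk hG4 hG6.
have hb : Num.sqrt 2 * b = pi * hypergeo2F1 (1 / 4) (3 / 4) 1 (1 - k ^+ 2).
  apply: (rect_period_imag b0 a0 hk); first by rewrite rG4.
  by rewrite rG6 mulrN hG6.
split.
  by rewrite wa; congr (_%:C); rewrite mulrAC -ha mulrC mulKf.
rewrite wb; congr ('i%C * _%:C); rewrite -mulrA -hb.
have s2 : Num.sqrt 2 ^+ 2 = 2 :> R by rewrite sqr_sqrtr.
rewrite (_ : _ * (_ * b) = Num.sqrt 2 ^+ 2 * b / 2); last by field.
by rewrite s2; field.
Qed.
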